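(* Let $m,k\in\mathbb{Z}_{\ge 2}$ be such that $m>2$ or $k>2$. Then the bipolar surfaces $\widetilde{\xi}_{m-1,k-1}$ and $\widetilde{\eta}_{m-1,k-1}$ in $\mathbb{S}^5$ of Lawson's minimal surfaces $\xi_{m-1,k-1}$ and $\eta_{m-1,k-1}$ in $\mathbb{S}^3$ are not embedded.
   Context: $\mathbb{S}^n\subseteq\mathbb{R}^{n+1}$ is the unit sphere with the induced metric. An immersion into $\mathbb{S}^n$ is minimal if its mean curvature vector vanishes. **Lawson's surfaces.** For $i\in\mathbb{Z}_{2k}$, $j\in\mathbb{Z}_{2m}$ put $P_i=(\cos(i\pi/k),\sin(i\pi/k),0,0)$ and $Q_j=(0,0,\cos(j\pi/m),\sin(j\pi/m))$ in $\mathbb{S}^3\subseteq\mathbb{R}^4$. Let $\Gamma_{\xi_{m-1,k-1}}$ be the closed geodesic polygon $P_0Q_0P_1Q_1$ (returning to $P_0$), successive vertices being joined by shortest great-circle arcs. Let $\Gamma_{\eta_{m-1,k-1}}$ be the closed geodesic polygon with successive vertices $Q_0$, $P_1$, $Q_1$, $-Q_1$ (returning to $Q_0$), where $Q_0P_1$, $P_1Q_1$ and $(-Q_1)Q_0$ are joined by shortest great-circle arcs, and $Q_1$ is joined to $-Q_1$ by the great-circle arc of length $\pi$ passing through $P_0$. Let $\Gamma$ be one of these polygons and $\Delta\subseteq\mathbb{R}^2$ the closed unit disk. By results of Lawson and others, there is a unique (up to reparametrization) solution $f:\Delta\to\mathbb{S}^3$ of the Plateau problem for $\Gamma$ (the area-minimizing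 disk bounded by $\Gamma$); it is a conformal minimal embedding of the open disk into the interior of the convex hull of $\Gamma$ (the intersection of all closed hemispheres containing $\Gamma$), and it maps $\partial\Delta$ one-to-one onto $\Gamma$. For a great circle $\gamma=P_\gamma\cap\mathbb{S}^3$ ($P_\gamma$ a 2-plane through the origin), the geodesic reflection $r_\gamma\in SO(4)$ is the identity on $P_\gamma$ and minus the identity on $P_\gamma^\perp$. Let $\gamma_1,\dots,\gamma_N$ be the great circles containing the boundary arcs of $\Gamma$, and let $G\subseteq SO(4)$ be the (finite) group generated by $r_{\gamma_1},\dots,r_{\gamma_N}$. For $p\in\Delta$ let $G^p\subseteq G$ be the subgroup generated by those $r_{\gamma_i}$ for which $f(p)$ lies on the boundary arc of $\Gamma$ contained in $\gamma_i$. On $G\times\Delta$ put $(g,p)\sim(h,q)$ iff $g(f(p))=h(f(q))$ and $g^{-1}h\in G^p$. Then $S=(G\times\Delta)/\!\sim$ is a closed smooth 2-manifold, and $\psi:S\to\mathbb{S}^3$, $\psi([(g,p)])=g(f(p))$, is a minimal immersion describing the closed minimal surface $\xi_{m-1,k-1}$ resp. $\eta_{m-1,k-1}$ (Lawson). **Bipolar surface.** If $S$ is orientable, put $\overline{S}=S$, $\overline{\psi}=\psi$; if $S$ is non-orientable, let $\overline{S}\to S$ be the orientable double cover and $\overline{\psi}:\overline{S}\to\mathbb{S}^3$ the lift of $\psi$ (the composition with the covering). Let $\overline{\nu}:\overline{S}\to\mathbb{S}^3$ be a Gauss map of $\overline{\psi}$, i.e. a smooth unit normal field along $\overline{\psi}$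 tangent to $\mathbb{S}^3$. Identify $\Lambda^2\mathbb{R}^4\cong\mathbb{R}^6$ with the inner product $\langle v_1\wedge v_2,w_1\wedge w_2\rangle=\det(\langle v_i,w_j\rangle)$. The bipolar immersion is $\widetilde{\psi}=\overline{\psi}\wedge\overline{\nu}:\overline{S}\to\mathbb{S}^5\subseteq\Lambda^2\mathbb{R}^4$; it is again a minimal immersion, and the surface it describes is $\widetilde{\xi}_{m-1,k-1}$ resp. $\widetilde{\eta}_{m-1,k-1}$. **Embeddedness.** The bipolar surface is considered on its smallest (fundamental) domain: the quotient $\Sigma$ of $\overline{S}$ under a smooth covering map $\overline{S}\to\Sigma$ such that $\widetilde{\psi}$ descends to an immersion $\Sigma\to\mathbb{S}^5$ that is injective up to self-intersections (i.e. it does not factor through a further nontrivial covering $\Sigma\to\Sigma'$). The bipolar surface is embedded if this immersion of $\Sigma$ is an embedding (equivalently, injective). *)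

(* Defs.v *)
From HB Require Import structures.
From mathcomp Require Import all_boot all_order all_algebra.
From mathcomp Require Import all_classical all_reals all_analysis.
From mathcomp Require Import ring.
Import Order.TTheory GRing.Theory Num.Theory.
Import numFieldNormedType.Exports.

Set Implicit Arguments.
Unset Strict Implicit.
Unset Printing Implicit Defensive.

Local Open Scope classical_set_scope.
Local Open Scope ring_scope.

Section EuclideanCalculus.
Context {R : realType}.

(* The library norm on ['rV_n] is the sup norm (same topology); all metric
   notions below use [dotv]. *)
Definition dotv {n : nat} (u v : 'rV[R]_n) : R := \sum_(i < n) u 0 i * v 0 i.

(* S^n in R^(n+1) *)
Definition sphere (n : nat) : set 'rV[R]_n.+1 := [set x | dotv x x = 1].

(* [U] is always open in the uses below. *)
Fixpoint class_C {V W : normedModType R} (r : nat) (U : set V) (F : V -> W)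
    : Prop :=
  match r with
  | 0 => forall x, U x -> {for x, continuous F}
  | r'.+1 => (forall x, U x -> differentiable F x) /\
             (forall v, class_C r' U (fun x => 'D_v F x))
  end.

Definition smooth_on {V W : normedModType R} (U : set V) (F : V -> W) : Prop :=
  forall r, class_C r U F.

Section Parametrized.
Context {n : nat}.
Implicit Types (X : 'rV[R]_2 -> 'rV[R]_n) (u : 'rV[R]_2).

Definition partial (i : 'I_2) X u : 'rV[R]_n := 'D_(delta_mx 0 i) X u.

(* the first fundamental form *)
Definition gram X u : 'M[R]_2 :=
  \matrix_(i, j) dotv (partial i X u) (partial j X u).

(* For X with values in the unit sphere: the component of the second
   derivative of X which is orthogonal to the position vector X (normal to the
   sphere) and to the tangent plane spanned by the partial derivatives. *)
Definition second_form X (i j : 'I_2) u : 'rV[R]_n :=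
  let w := partial i (partial j X) u in
  w - dotv w (X u) *: X u
    - \sum_(a < 2) \sum_(b < 2)
        (invmx (gram X u) a b * dotv w (partial a X u)) *: partial b X u.

Definition mean_curvature X u : 'rV[R]_n :=
  2^-1 *: \sum_(i < 2) \sum_(j < 2)
            invmx (gram X u) i j *: second_form X i j u.

End Parametrized.
End EuclideanCalculus.

Arguments sphere R n : clear implicits.

Section Surfaces.
Context {R : realType}.

(* [chart_map] and [chart_inv] are total functions; only the values on the
   domain, respectively on its image, matter. *)
Record chart (M : topologicalType) : Type := Chart {
  chart_dom : set M;
  chart_map : M -> 'rV[R]_2;
  chart_inv : 'rV[R]_2 -> M }.

Definition chart_cod (M : topologicalType) (c : chart M) : set 'rV[R]_2 :=
  chart_map c @` chart_dom c.

Definition is_chart (M : topologicalType) (c : chart M) : Prop :=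
  [/\ open (chart_dom c), open (chart_cod c),
      {in chart_dom c, continuous (chart_map c)},
      {in chart_cod c, continuous (chart_inv c)} &
      {in chart_dom c, cancel (chart_map c) (chart_inv c)}].

Definition transition (M : topologicalType) (c d : chart M)
    : 'rV[R]_2 -> 'rV[R]_2 := chart_map d \o chart_inv c.

Definition smooth_atlas (M : topologicalType) (A : set (chart M)) : Prop :=
  [/\ forall c, A c -> is_chart c,
      forall x, exists2 c, A c & chart_dom c x &
      forall c d, A c -> A d ->
        smooth_on (chart_map c @` (chart_dom c `&` chart_dom d))
                  (transition c d)].

Record smooth_structure (M : topologicalType) : Type := SmoothStructure {
  atlas : set (chart M);
  atlasP : smooth_atlas atlas;
  surface_hausdorff : hausdorff_space M;
  surface_second_countable : @second_countable M }.

(* Smooth 2-manifolds without boundary; the atlas need not be maximal. *)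
Record surface : Type := Surface {
  surface_space :> topologicalType;
  surface_structure : smooth_structure surface_space }.

Definition charts (M : surface) : set (chart M) := atlas (surface_structure M).

Definition closed_surface (M : surface) : Prop := compact [set: M].

Definition smooth_map_on (M N : surface) (U : set M) (F : M -> N) : Prop :=
  (forall x, U x -> {for x, continuous F}) /\
  forall c d, charts c -> charts d ->
    smooth_on (chart_map c @` (U `&` chart_dom c `&` F @^-1` chart_dom d))
              (chart_map d \o F \o chart_inv c).

Definition diffeo_between (M N : surface) (U : set M) (V : set N) (F : M -> N)
    : Prop :=
  smooth_map_on U F /\
  exists G : N -> M,
    [/\ smooth_map_on V G,
        forall x, U x -> V (F x) /\ G (F x) = x &
        forall y, V y -> U (G y) /\ F (G y) = y].

Definition smooth_covering (M N : surface) (p : M -> N) : Prop :=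
  (forall y, exists x, p x = y) /\
  forall y, exists V : set N,
    [/\ open V, V y &
        exists sheets : set (set M),
          [/\ forall U, sheets U -> open U /\ diffeo_between U V p,
              forall U U', sheets U -> sheets U' ->
                U `&` U' !=set0 -> U = U' &
              p @^-1` V = \bigcup_(U in sheets) U]].

(* an atlas [B] of positively compatible charts inside the smooth structure *)
Definition orientable (M : surface) : Prop :=
  exists B : set (chart M),
    [/\ smooth_atlas (charts (M := M) `|` B),
        forall x, exists2 c, B c & chart_dom c x &
        forall c d x, B c -> B d -> chart_dom c x -> chart_dom d x ->
          0 < \det (jacobian (transition c d) (chart_map c x))].

Section MapsToSpheres.
Context {n : nat} (M : surface).
Implicit Types (F : M -> 'rV[R]_n.+1).

Definition smooth_vector_map F : Prop :=
  forall c, charts c -> smooth_on (chart_cod c) (F \o chart_inv c).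

Definition immersion_in_sphere F : Prop :=
  [/\ forall x, sphere R n (F x),
      smooth_vector_map F &
      forall c u, charts c -> chart_cod c u ->
        forall v, 'D_v (F \o chart_inv c) u = 0 -> v = 0].

Definition minimal_immersion F : Prop :=
  immersion_in_sphere F /\
  forall c u, charts c -> chart_cod c u ->
    mean_curvature (F \o chart_inv c) u = 0.

Definition embedding_in_sphere F : Prop :=
  [/\ immersion_in_sphere F, injective F &
      forall U : set M, open U ->
        exists2 V : set 'rV[R]_n.+1, open V & F @` U = range F `&` V].

Definition gauss_map F (nu : M -> 'rV[R]_n.+1) : Prop :=
  [/\ smooth_vector_map nu,
      forall x, sphere R n (nu x),
      forall x, dotv (nu x) (F x) = 0 &
      forall c u, charts c -> chart_cod c u ->
        forall v, dotv (nu (chart_inv c u)) ('D_v (F \o chart_inv c) u) = 0].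

End MapsToSpheres.

(* [F] descends along the covering [p : M -> Sigma] to the immersion [phi],
   which does not factor through any further nontrivial covering. *)
Definition fundamental_domain (n : nat) (M Sigma : surface) (p : M -> Sigma)
    (F : M -> 'rV[R]_n.+1) (phi : Sigma -> 'rV[R]_n.+1) : Prop :=
  [/\ smooth_covering p,
      immersion_in_sphere phi,
      F = phi \o p &
      forall (Sigma' : surface) (q : Sigma -> Sigma')
             (phi' : Sigma' -> 'rV[R]_n.+1),
        smooth_covering q -> immersion_in_sphere phi' -> phi = phi' \o q ->
        injective q].

Definition embedded_surface (n : nat) (M : surface) (F : M -> 'rV[R]_n.+1)
    : Prop :=
  exists (Sigma : surface) (p : M -> Sigma) (phi : Sigma -> 'rV[R]_n.+1),
    fundamental_domain p F phi /\ embedding_in_sphere phi.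

Definition orientable_double_cover (M Mbar : surface) (p : Mbar -> M) : Prop :=
  [/\ orientable Mbar, smooth_covering p &
      forall y, exists x1 x2, x1 <> x2 /\ p @^-1` [set y] = [set x1; x2]].

Inductive orientation_cover (M : surface)
    : forall Mbar : surface, (Mbar -> M) -> Prop :=
| OrientationTrivial :
    orientable M -> orientation_cover (fun x : M => x)
| OrientationDouble (Mbar : surface) (p : Mbar -> M) :
    ~ orientable M -> orientable_double_cover p -> orientation_cover p.

End Surfaces.

Arguments surface R : clear implicits.
Arguments smooth_structure R M : clear implicits.

Section Plateau.
Context {R : realType}.

Definition closed_disk : set 'rV[R]_2 := [set p | dotv p p <= 1].
Definition open_disk : set 'rV[R]_2 := [set p | dotv p p < 1].
Definition unit_circle : set 'rV[R]_2 := [set p | dotv p p = 1].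

(* An arc of the great circle cut out by the plane spanned by two linearly
   independent vectors. *)
Record edge : Type := Edge {
  edge_u : 'rV[R]_4;
  edge_v : 'rV[R]_4;
  edge_arc : set 'rV[R]_4;
  edge_arcP : forall x, edge_arc x -> exists s t, x = s *: edge_u + t *: edge_v }.

(* The shortest arc between independent unit vectors u and v is the radial
   projection of the segment [u, v]. *)
Definition shortest_arc (u v : 'rV[R]_4) : set 'rV[R]_4 :=
  [set x | sphere R 3 x /\
           exists s t, [/\ 0 <= s, 0 <= t & x = s *: u + t *: v]].

(* the arc of length pi from u to -u through v *)
Definition half_circle (u v : 'rV[R]_4) : set 'rV[R]_4 :=
  [set x | sphere R 3 x /\ exists s t, 0 <= t /\ x = s *: u + t *: v].

Lemma shortest_arcP u v x :
  shortest_arc u v x -> exists s t, x = s *: u + t *: v.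
Proof. by case=> _ [s [t [_ _ ->]]]; exists s, t. Qed.

Lemma half_circleP u v x :
  half_circle u v x -> exists s t, x = s *: u + t *: v.
Proof. by case=> _ [s [t [_ ->]]]; exists s, t. Qed.

Definition shortest_edge (u v : 'rV[R]_4) : edge := Edge (@shortest_arcP u v).
Definition half_circle_edge (u v : 'rV[R]_4) : edge := Edge (@half_circleP u v).

(* A polygon is given by its set of edges. *)
Definition polygon : Type := set edge.

Definition trace (Gamma : polygon) : set 'rV[R]_4 :=
  \bigcup_(e in Gamma) edge_arc e.

Definition vec2 (x y : R) : 'rV[R]_2 := \row_(i < 2) nth 0 [:: x; y] i.
Definition vec4 (x y z w : R) : 'rV[R]_4 := \row_(i < 4) nth 0 [:: x; y; z; w] i.

Definition vP (k i : nat) : 'rV[R]_4 :=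
  vec4 (cos (i%:R * pi / k%:R)) (sin (i%:R * pi / k%:R)) 0 0.
Definition vQ (m j : nat) : 'rV[R]_4 :=
  vec4 0 0 (cos (j%:R * pi / m%:R)) (sin (j%:R * pi / m%:R)).

(* the polygons defining the surfaces xi_(m-1,k-1) and eta_(m-1,k-1) *)
Definition xi_polygon (m k : nat) : polygon :=
  [set shortest_edge (vP k 0) (vQ m 0); shortest_edge (vQ m 0) (vP k 1);
       shortest_edge (vP k 1) (vQ m 1); shortest_edge (vQ m 1) (vP k 0)].

Definition eta_polygon (m k : nat) : polygon :=
  [set shortest_edge (vQ m 0) (vP k 1); shortest_edge (vP k 1) (vQ m 1);
       half_circle_edge (vQ m 1) (vP k 0);
       shortest_edge (- vQ m 1) (vQ m 0)].

(* the intersection of the closed hemispheres containing the given set *)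
Definition spherical_hull (C : set 'rV[R]_4) : set 'rV[R]_4 :=
  [set x | sphere R 3 x /\
           forall a, sphere R 3 a -> (forall y, C y -> 0 <= dotv a y) ->
             0 <= dotv a x].

(* interior relative to S^3 *)
Definition sphere_interior (C : set 'rV[R]_4) : set 'rV[R]_4 :=
  [set x | sphere R 3 x /\ within (sphere R 3) (nbhs x) C].

Definition area (f : 'rV[R]_2 -> 'rV[R]_4) : \bar R :=
  (\int[lebesgue_measure \x lebesgue_measure]_(z in
      [set z : R * R | open_disk (vec2 z.1 z.2)])
     (Num.sqrt (\det (gram f (vec2 z.1 z.2))))%:E)%E.

Definition disk_spanning (Gamma : polygon) (f : 'rV[R]_2 -> 'rV[R]_4) : Prop :=
  [/\ forall p, closed_disk p -> sphere R 3 (f p),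
      {within closed_disk, continuous f},
      class_C 1 open_disk f,
      {in unit_circle &, injective f} &
      f @` unit_circle = trace Gamma].

(* The solution of the Plateau problem is the area-minimizing disk in conformal
   parametrization. The further classical properties of this disk (smooth and
   minimal inside, embedded, contained in the interior of the hull of Gamma,
   one-to-one on the boundary) are part of the specification. *)
Definition plateau_solution (Gamma : polygon) (f : 'rV[R]_2 -> 'rV[R]_4)
    : Prop :=
  [/\ disk_spanning Gamma f /\
        (forall h, disk_spanning Gamma h -> (area f <= area h)%E),
      smooth_on open_disk f /\
        (forall p, open_disk p -> exists2 l, 0 < l & gram f p = l%:M),
      forall p, open_disk p -> mean_curvature f p = 0,
      {in open_disk &, injective f} /\
        (forall U, open U -> U `<=` open_disk ->
           exists2 V : set 'rV[R]_4, open V & f @` U = (f @` open_disk) `&` V) &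
      f @` open_disk `<=` sphere_interior (spherical_hull (trace Gamma))].

End Plateau.

Arguments edge R : clear implicits.
Arguments polygon R : clear implicits.
Arguments xi_polygon R m k : clear implicits.
Arguments eta_polygon R m k : clear implicits.

Section LawsonSurface.
Context {R : realType}.
Implicit Types (Gamma : polygon R) (f : 'rV[R]_2 -> 'rV[R]_4).

(* Matrices act on vectors as column vectors, so that
   act (g * h) v = act g (act h v). *)
Definition act (g : 'M[R]_4) (v : 'rV[R]_4) : 'rV[R]_4 := v *m g^T.

Definition special_orthogonal (g : 'M[R]_4) : Prop :=
  g *m g^T = 1%:M /\ \det g = 1.

(* [r] is the geodesic reflection in the great circle containing [e]. *)
Definition is_reflection (e : edge R) (r : 'M[R]_4) : Prop :=
  [/\ special_orthogonal r,
      forall s t, act r (s *: edge_u e + t *: edge_v e) =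
                  s *: edge_u e + t *: edge_v e &
      forall w, dotv w (edge_u e) = 0 -> dotv w (edge_v e) = 0 ->
        act r w = - w].

Definition subgroup (H : set 'M[R]_4) : Prop :=
  [/\ H 1, forall g h, H g -> H h -> H (g * h) & forall g, H g -> H g^-1].

Definition generated (X : set 'M[R]_4) : set 'M[R]_4 :=
  \bigcap_(H in [set H | subgroup H /\ X `<=` H]) H.

Definition reflections Gamma : set 'M[R]_4 :=
  [set r | exists2 e, Gamma e & is_reflection e r].

Definition reflection_group Gamma : set 'M[R]_4 := generated (reflections Gamma).

(* the group G^p depends only on x = f p *)
Definition local_group Gamma (x : 'rV[R]_4) : set 'M[R]_4 :=
  generated (reflections (Gamma `&` [set e | edge_arc e x])).

Lemma actM (g h : 'M[R]_4) v : act (g * h) v = act g (act h v).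
Proof. by rewrite /act -mulmxA -trmx_mul. Qed.

Lemma act1 v : act 1 v = v.
Proof. by rewrite /act trmx1 mulmx1. Qed.

Lemma generated_subgroup X : subgroup (generated X).
Proof.
split=> [H [[]]//|g h Xg Xh H HP|g Xg H HP].
  by have [[_ + _] _] := HP; apply; [exact: Xg|exact: Xh].
by have [[_ _ +] _] := HP; apply; exact: Xg.
Qed.

Lemma generated_unit Gamma g :
  generated (reflections Gamma) g -> g \is a GRing.unit.
Proof.
move=> /(_ [set h | h \is a GRing.unit]); apply; split.
  split=> [|a b ua ub|a ua]; rewrite /= ?unitr1 ?unitrV //.
  by rewrite unitrMl.
move=> r [e _ [[rr _] _ _]]; change (r \in unitmx).
by case: (mulmx1_unit rr).
Qed.

Lemma local_group_subgroup Gamma x : subgroup (local_group Gamma x).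
Proof. exact: generated_subgroup. Qed.

Lemma local_group_fix Gamma x g : local_group Gamma x g -> act g x = x.
Proof.
move=> /(_ [set h | act h x = x]); apply; split.
  split=> [|a b ax bx|a ax] /=; first exact: act1.
    by rewrite actM bx ax.
  have [ua|ua] := boolP (a \is a GRing.unit).
    by rewrite -{1}ax -actM mulVr ?act1.
  by rewrite invr_out.
by move=> r [e [_ /edge_arcP[s [t ->]]] [_ + _]] /=.
Qed.

Section Quotient.
Variables (Gamma : polygon R) (f : 'rV[R]_2 -> 'rV[R]_4).

(* G x Delta, with the discrete topology on G *)
Definition lawson_pieces : Type :=
  (discrete_topology (reflection_group Gamma) * (@closed_disk R))%type.
HB.instance Definition _ := Topological.on lawson_pieces.

Definition piece_elt (x : lawson_pieces) : 'M[R]_4 :=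
  val (x.1 : reflection_group Gamma).
Definition piece_pt (x : lawson_pieces) : 'rV[R]_4 := f (val x.2).

Definition lawson_rel (x y : lawson_pieces) : bool :=
  `[< act (piece_elt x) (piece_pt x) = act (piece_elt y) (piece_pt y) /\
      local_group Gamma (piece_pt x) ((piece_elt x)^-1 * piece_elt y) >].

Lemma piece_elt_unit x : piece_elt x \is a GRing.unit.
Proof. by apply: (@generated_unit Gamma); apply/set_mem; exact: valP x.1. Qed.

Lemma lawson_rel_pt x y : lawson_rel x y -> piece_pt x = piece_pt y.
Proof.
move=> /asboolP[xy /local_group_fix lxy].
have := congr1 (act (piece_elt x)^-1) xy.
rewrite -!actM mulVr ?piece_elt_unit // act1 => xE.
have : act ((piece_elt x)^-1 * piece_elt y) (piece_pt x) =
       act ((piece_elt x)^-1 * piece_elt y) (piece_pt y) by rewrite lxy.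
move=> /(congr1 (act ((piece_elt x)^-1 * piece_elt y)^-1)).
by rewrite -!(actM _^-1) mulVr ?act1 // unitrMl ?unitrV ?piece_elt_unit.
Qed.

Lemma lawson_rel_equiv : equiv_class_of lawson_rel.
Proof.
split=> [x|x y|y x z].
- apply/asboolP; split=> //; rewrite mulVr ?piece_elt_unit //.
  by have [] := local_group_subgroup Gamma (piece_pt x).
- suff sym u v : lawson_rel u v -> lawson_rel v u by apply/idP/idP; exact: sym.
  move=> uv; have ptE := lawson_rel_pt uv; move/asboolP: uv => [uv luv].
  apply/asboolP; split=> //; rewrite -ptE.
  have -> : (piece_elt v)^-1 * piece_elt u = ((piece_elt u)^-1 * piece_elt v)^-1.
    by rewrite invrM ?unitrV ?piece_elt_unit // invrK.
  by have [_ _] := local_group_subgroup Gamma (piece_pt u); exact.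
- move=> xy yz; have ptE := lawson_rel_pt xy.
  move/asboolP: xy => [xy lxy]; move/asboolP: yz => [yz lyz].
  apply/asboolP; split; first by rewrite xy.
  have -> : (piece_elt x)^-1 * piece_elt z =
      ((piece_elt x)^-1 * piece_elt y) * ((piece_elt y)^-1 * piece_elt z).
    by rewrite mulrA mulrK ?piece_elt_unit.
  have [_ M _] := local_group_subgroup Gamma (piece_pt x).
  by apply: M => //; rewrite ptE.
Qed.

Canonical lawson_equiv := EquivRelPack lawson_rel_equiv.

Definition lawson_space : topologicalType :=
  quotient_topology {eq_quot lawson_equiv}%qT.

Definition lawson_map (s : lawson_space) : 'rV[R]_4 :=
  let x := repr (s : {eq_quot lawson_equiv}%qT) in act (piece_elt x) (piece_pt x).

Lemma lawson_mapE (x : lawson_pieces) :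
  lawson_map (\pi_({eq_quot lawson_equiv})%qT x) = act (piece_elt x) (piece_pt x).
Proof.
rewrite /lawson_map; have /eqmodP /asboolP[] // := 
  reprK (\pi_({eq_quot lawson_equiv})%qT x).
Qed.

End Quotient.
End LawsonSurface.

Section Bipolar.
Context {R : realType}.

Definition minor (u v : 'rV[R]_4) (i j : 'I_4) : R :=
  u 0 i * v 0 j - u 0 j * v 0 i.

Local Notation ix i := (@Ordinal 4 i isT).

(* coordinates in the orthonormal basis of the e_i /\ e_j, i < j *)
Definition wedge (u v : 'rV[R]_4) : 'rV[R]_6 :=
  \row_(l < 6) nth 0 [:: minor u v (ix 0) (ix 1); minor u v (ix 0) (ix 2);
                         minor u v (ix 0) (ix 3); minor u v (ix 1) (ix 2);
                         minor u v (ix 1) (ix 3); minor u v (ix 2) (ix 3)] l.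

Lemma dotv_wedge (u v w z : 'rV[R]_4) :
  dotv (wedge u v) (wedge w z) = dotv u w * dotv v z - dotv u z * dotv v w.
Proof.
rewrite /dotv !big_ord_recl !big_ord0 !mxE /= /minor.
have -> : ix 0 = ord0 by apply/val_inj.
have -> : ix 1 = lift ord0 ord0 by apply/val_inj.
have -> : ix 2 = lift ord0 (lift ord0 ord0) by apply/val_inj.
have -> : ix 3 = lift ord0 (lift ord0 (lift ord0 ord0)) by apply/val_inj.
ring.
Qed.

Definition bipolar (M : Type) (psi nu : M -> 'rV[R]_4) : M -> 'rV[R]_6 :=
  fun x => wedge (psi x) (nu x).

End Bipolar.

(* Main.v *)
(* Both polygons contain the path of edges Q_0, P_1, Q_1, P_0.  Read it as
   c, a, b, d, with a = P_1 when k > 2 and backwards, with a = Q_1, when m > 2.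
   The edges ab and ac force the unit normal n at the vertex a to be orthogonal
   to b and c, and since the surface is minimal and contains the geodesic ab,
   the shape operator at a is l times the swap of b and of c', the unit tangent
   vector orthogonal to b.  So the bipolar surface has tangent plane
   W = <b^n + l a^c', c'^n + l a^b> at the point a^n.

   The reflection r in the edge bd preserves the surface and reverses its
   normal, so over r a lies a point with normal - r n.  As (r a, - r n) is (a, n)
   turned by some angle t in their plane, both points have the same image
   a^n.  If the bipolar surface were embedded, W would equal r W, which forces
   (1 + l^2) sin t = 0; but t is twice the angle between a and d, and that angle,
   pi/k or pi/m, lies strictly between 0 and pi/2.

   Tangent planes are compared through the topological notion of a conormal
   vector, because the symmetries of the surface are only known to be
   homeomorphisms. *)

Require Import Defs.
From mathcomp Require Import all_boot all_order all_algebra.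
From mathcomp Require Import all_classical all_reals all_analysis.
From mathcomp Require Import ring lra.
Import Order.TTheory GRing.Theory Num.Theory.
Import numFieldNormedType.Exports.

Set Implicit Arguments.
Unset Strict Implicit.
Unset Printing Implicit Defensive.

Local Open Scope classical_set_scope.
Local Open Scope ring_scope.

(** * Calculus of inner products *)

(** The disk is known to be smooth only in its interior, while the argument takes place at vertices
    of its boundary. All first-order information there comes from the immersion of the closed
    surface; the edges enter merely as points of the surface accumulating at a vertex, found in the
    quotient by compactness of the unit circle.

    The sign in - r n is the delicate point. A symmetry of the surface determines the transported
    normal only up to sign, and in the non-orientable case the sign also depends on the chosen
    lifts. It is read off at the vertex b, where a piece meets its mirror image, and carried to the
    vertex a through the connected disk.

    The number l is never computed: a symmetric trace-free shape operator has two unknown entries,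
    the edge ab kills the diagonal one, and the other enters only through 1 + l^2 > 0. *)

Section InnerProduct.
Context {R : realType} {n : nat}.
Implicit Types u v w : 'rV[R]_n.

Lemma dotvC u v : dotv u v = dotv v u.
Proof. by apply: eq_bigr => i _; rewrite mulrC. Qed.

Lemma dotv_mx u v : dotv u v = (u *m v^T) 0 0.
Proof. by rewrite mxE; apply: eq_bigr => i _; rewrite mxE. Qed.

Lemma dotvDl u v w : dotv (u + v) w = dotv u w + dotv v w.
Proof. by rewrite !dotv_mx mulmxDl mxE. Qed.

Lemma dotvNl u w : dotv (- u) w = - dotv u w.
Proof. by rewrite !dotv_mx mulNmx mxE. Qed.

Lemma dotvZl a u w : dotv (a *: u) w = a * dotv u w.
Proof. by rewrite !dotv_mx -scalemxAl mxE. Qed.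

Lemma dotvBl u v w : dotv (u - v) w = dotv u w - dotv v w.
Proof. by rewrite dotvDl dotvNl. Qed.

Lemma dotv0l w : dotv 0 w = 0.
Proof. by rewrite !dotv_mx mul0mx mxE. Qed.

Lemma dotvDr u v w : dotv w (u + v) = dotv w u + dotv w v.
Proof. by rewrite dotvC dotvDl !(dotvC w). Qed.

Lemma dotvNr u w : dotv w (- u) = - dotv w u.
Proof. by rewrite dotvC dotvNl !(dotvC w). Qed.

Lemma dotvZr a u w : dotv w (a *: u) = a * dotv w u.
Proof. by rewrite dotvC dotvZl !(dotvC w). Qed.

Lemma dotvBr u v w : dotv w (u - v) = dotv w u - dotv w v.
Proof. by rewrite dotvC dotvBl !(dotvC w). Qed.

Lemma dotv0r w : dotv w 0 = 0.
Proof. by rewrite dotvC dotv0l. Qed.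

Lemma dotv_ge0 u : 0 <= dotv u u.
Proof. by apply: sumr_ge0 => i _; rewrite -expr2 sqr_ge0. Qed.

Lemma dotv_eq0 u : dotv u u = 0 -> u = 0.
Proof.
move=> u0; apply/rowP => i; rewrite mxE; apply/eqP; rewrite -sqrf_eq0 expr2.
apply/eqP; apply: psumr_eq0P u0 i isT => j _.
by rewrite -expr2 sqr_ge0.
Qed.

Lemma coord_norm_le u i : `|u 0 i| <= `|u|.
Proof.
rewrite [leRHS]/Num.Def.normr/= mx_normrE.
exact: (le_bigmax _ (fun ij : 'I_1 * 'I_n => `|u ij.1 ij.2|) (0, i)).
Qed.

(** Derivatives are taken in the sup norm; this bound and [dotv_le_norm] give the passage to the
    Euclidean length, in which conormality is stated. *)
Lemma norm_sqr_le_dotv u : `|u| ^+ 2 <= dotv u u.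
Proof.
rewrite -ler_sqrt ?dotv_ge0 // sqrtr_sqr normr_id.
rewrite [leLHS]/Num.Def.normr/= mx_normrE; apply: bigmax_le => //=.
move=> [k i] _ /=; rewrite (ord1 k) -sqrtr_sqr ler_sqrt ?dotv_ge0 //.
rewrite /dotv (bigD1 i) //= -expr2 lerDl.
by apply: sumr_ge0 => j _; rewrite -expr2 sqr_ge0.
Qed.

Lemma dotv_le_norm u v : `|dotv u v| <= n%:R * (`|u| * `|v|).
Proof.
apply: le_trans (ler_norm_sum _ _ _) _.
apply: (@le_trans _ _ (\sum_(i < n) `|u| * `|v|)).
  by apply: ler_sum => i _; rewrite normrM ler_pM // coord_norm_le.
by rewrite sumr_const card_ord mulr_natl.
Qed.

End InnerProduct.

Section DotDerivative.
Context {R : realType} {V : normedModType R} {n : nat}.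
Implicit Types F G : V -> 'rV[R]_n.

Lemma differentiable_entry F x i :
  differentiable F x -> differentiable (fun y => F y 0 i) x.
Proof.
move=> dF.
exact: (differentiable_comp dF (differentiable_coord (F x) 0 i)).
Qed.

Lemma dotv_differentiable F G x : differentiable F x -> differentiable G x ->
  differentiable (fun y => dotv (F y) (G y)) x.
Proof.
move=> dF dG.
have -> : (fun y => dotv (F y) (G y)) =
    \sum_(i < n) (fun y => F y 0 i) * (fun y => G y 0 i).
  by apply/funext => y; rewrite fct_sumE.
by apply: differentiable_sum => i; apply: differentiableM;
  exact: differentiable_entry.
Qed.

Lemma derive_coord F x v i : derivable F x v ->
  'D_v (fun y => F y 0 i) x = ('D_v F x) 0 i.
Proof. by move=> dF; rewrite derive_mx // mxE. Qed.

Lemma derivable_coord F x v i : derivable F x v ->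
  derivable (fun y => F y 0 i) x v.
Proof. by move/derivable_mxP; apply. Qed.

Lemma is_derive_dotv F G x v : derivable F x v -> derivable G x v ->
  is_derive x v (fun y => dotv (F y) (G y))
    (dotv ('D_v F x) (G x) + dotv (F x) ('D_v G x)).
Proof.
move=> dF dG.
have -> : (fun y => dotv (F y) (G y)) =
    \sum_(i < n) (fun y => F y 0 i) * (fun y => G y 0 i).
  by apply/funext => y; rewrite fct_sumE.
have -> : dotv ('D_v F x) (G x) + dotv (F x) ('D_v G x) =
    \sum_(i < n) (F x 0 i *: 'D_v (fun y => G y 0 i) x +
                  G x 0 i *: 'D_v (fun y => F y 0 i) x).
  rewrite -big_split; apply: eq_bigr => i _ /=.
  by rewrite !derive_coord // addrC [X in _ + X]mulrC.
apply: is_derive_sum => i; apply: is_deriveM;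
  apply: derivableP; exact: derivable_coord.
Qed.

Lemma derive_dotv F G x v : derivable F x v -> derivable G x v ->
  'D_v (fun y => dotv (F y) (G y)) x =
    dotv ('D_v F x) (G x) + dotv (F x) ('D_v G x).
Proof. by move=> dF dG; have [] := is_derive_dotv dF dG. Qed.

Lemma derive_dotv_cst F (a : 'rV[R]_n) x v : derivable F x v ->
  'D_v (fun y => dotv (F y) a) x = dotv ('D_v F x) a.
Proof.
move=> dF; rewrite (derive_dotv dF (derivable_cst a x v)) derive_cst.
by rewrite dotv0r addr0.
Qed.

Lemma differentiable_rV F x :
  (forall i, differentiable (fun y => F y 0 i) x) -> differentiable F x.
Proof.
move=> dF; rewrite (_ : F = \sum_(i < n) (fun y => F y 0 i *: delta_mx 0 i)).
  by apply: differentiable_sum => i; apply: differentiableZl.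
by apply/funext => y; rewrite fct_sumE /= [LHS]row_sum_delta.
Qed.

End DotDerivative.

(** * Conormal vectors *)

Section FirstOrder.
Context {R : realType}.

Lemma diff_near {V W : normedModType R} (F : V -> W) (u : V) :
  differentiable F u -> forall e, 0 < e ->
  \forall w \near u, `|F w - F u - 'd F u (w - u)| <= e * `|w - u|.
Proof.
move=> dF e e0; have /eqaddoP /(_ e e0) H := diff_locally dF.
have [d d0 dP] := (nbhs_ballP _ _).1 H.
apply/nbhs_ballP; exists d => //= w wd.
have /dP : ball 0 d (w - u).
  by move: wd; rewrite -!ball_normE /ball_ /= sub0r opprB.
by rewrite /= !fctE /= subrK opprD addrA.
Qed.

(** The matrix of an injective map is row free, so its pseudo-inverse [P] undoes it; [C] comes from
    the columns of [P], with 1 added to keep it positive in every dimension. *)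
Lemma injective_linear_bound {m n} (L : {linear 'rV[R]_m -> 'rV[R]_n}) :
  (forall v, L v = 0 -> v = 0) ->
  exists2 C : R, 0 < C & forall v : 'rV[R]_m, `|v| <= C * `|L v|.
Proof.
move=> L0; have /mulmxKp MK : row_free (lin1_mx L).
  by apply: inj_row_free => v; rewrite mul_rV_lin1; exact: L0.
pose P := pinvmx (lin1_mx L).
pose B := \sum_(i < m) `|(row i P^T : 'rV_n)|.
exists (n%:R * B + 1).
  by rewrite ltr_wpDl // mulr_ge0 // sumr_ge0.
move=> v.
have vi i : `|v 0 i| <= (n%:R * B + 1) * `|L v|.
  have -> : v 0 i = dotv (L v) (row i P^T).
    rewrite -[in LHS](MK _ v) mul_rV_lin1 mxE /dotv.
    by apply: eq_bigr => j _; rewrite !mxE.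
  apply: le_trans (dotv_le_norm _ _) _.
  rewrite mulrCA mulrC ler_wpM2r //.
  apply: (@le_trans _ _ (n%:R * B)); last by rewrite lerDl.
  by rewrite ler_wpM2l // /B (bigD1 i) //= lerDl sumr_ge0.
rewrite [leLHS]/Num.Def.normr/= mx_normrE; apply: bigmax_le => [|[k i] _ /=].
  by rewrite mulr_ge0 // addr_ge0 // mulr_ge0 // sumr_ge0.
by rewrite (ord1 k) vi.
Qed.

Section Immersion.
Context {m n : nat} (X : 'rV[R]_m -> 'rV[R]_n) (u : 'rV[R]_m).
Hypotheses (dX : differentiable X u) (iX : forall v, 'D_v X u = 0 -> v = 0).

Lemma immersion_lower_bound :
  exists2 C, 0 < C & \forall w \near u, `|w - u| <= C * `|X w - X u|.
Proof.
have [v|C C0 CP] := @injective_linear_bound _ _ ('d X u).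
  by rewrite -deriveE //; exact: iX.
exists (2 * C); first by rewrite mulr_gt0.
(* Multiplied by [C], the linearization error then takes only half of |w - u|, which is absorbed on
   the left. *)
have e0 : 0 < (2 * C)^-1 by rewrite invr_gt0 mulr_gt0.
near=> w.
have H : `|X w - X u - 'd X u (w - u)| <= (2 * C)^-1 * `|w - u|.
  by near: w; exact: (diff_near dX e0).
have H1 : `|'d X u (w - u)| <= `|X w - X u| + (2 * C)^-1 * `|w - u|.
  have := ler_normB (X w - X u) (X w - X u - 'd X u (w - u)).
  by rewrite opprB addrC subrK => /le_trans; apply; rewrite lerD2l.
have := CP (w - u); rewrite -(ler_pM2l C0) in H1.
have CE t : C * ((2 * C)^-1 * t) = t / 2 by field; rewrite gt_eqF.
move: H1; rewrite mulrDr CE => /[swap] /le_trans /[apply].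
lra.
Unshelve. all: by end_near. Qed.

(** The increment of a critical [phi] is o(|w - u|), and the lower bound for immersions turns this
    into o(|X w - X u|), an estimate between values in which the parameter no longer appears. *)
Lemma critical_littleo (phi : 'rV[R]_m -> R) : differentiable phi u ->
  (forall v, 'D_v phi u = 0) -> forall e, 0 < e ->
  \forall w \near u,
    (phi w - phi u) ^+ 2 <= e * dotv (X w - X u) (X w - X u).
Proof.
move=> dphi phi0 e e0; have [C C0 CP] := immersion_lower_bound.
pose d := Num.sqrt e / C.
have d0 : 0 < d by rewrite divr_gt0 // sqrtr_gt0.
near=> w.
have : `|phi w - phi u - 'd phi u (w - u)| <= d * `|w - u|.
  by near: w; exact: (diff_near dphi d0).
rewrite -deriveE // phi0 subr0 => H.
have H1 : `|w - u| <= C * `|X w - X u| by near: w.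
have {H1}H : `|phi w - phi u| <= Num.sqrt e * `|X w - X u|.
  apply: le_trans H _; rewrite -(ler_pM2l d0) in H1; apply: le_trans H1 _.
  by rewrite mulrA divfK // gt_eqF.
rewrite -real_normK ?num_real //; apply: (@le_trans _ _ (e * `|X w - X u| ^+ 2)).
  rewrite -[e in leRHS](sqr_sqrtr (ltW e0)) -exprMn.
  by rewrite ler_sqr ?nnegrE // mulr_ge0 // sqrtr_ge0.
by rewrite ler_pM2l // norm_sqr_le_dotv.
Unshelve. all: by end_near. Qed.

End Immersion.

(* The covectors annihilating the tangent plane of F at x, described without
   charts so that homeomorphisms transport them. *)
Definition conormal {T : topologicalType} {n} (F : T -> 'rV[R]_n) (x : T)
    (a : 'rV[R]_n) : Prop :=
  forall e, 0 < e -> \forall y \near x,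
    dotv a (F y - F x) ^+ 2 <= e * dotv (F y - F x) (F y - F x).

(** Only squares and lengths are compared, so continuity of [h] suffices and the values may change
    by an isometry or a sign. *)
Lemma conormal_pullback {T U : topologicalType} {m n} (F : T -> 'rV[R]_m)
    (G : U -> 'rV[R]_n) (h : U -> T) (y : U) a b :
  {for y, continuous h} -> conormal F (h y) a ->
  (\forall z \near y,
     dotv b (G z - G y) ^+ 2 = dotv a (F (h z) - F (h y)) ^+ 2 /\
     dotv (G z - G y) (G z - G y) =
       dotv (F (h z) - F (h y)) (F (h z) - F (h y))) ->
  conormal G y b.
Proof.
move=> hc Fa H e e0; by have := hc _ (Fa e e0); apply: filterS2 H => z [-> ->].
Qed.

Lemma immersion_conormal {m n} (X : 'rV[R]_m -> 'rV[R]_n) u a :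
  differentiable X u -> (forall v, 'D_v X u = 0 -> v = 0) ->
  (forall v, dotv a ('D_v X u) = 0) -> conormal X u a.
Proof.
move=> dX iX aX e e0.
have dphi : differentiable (fun w => dotv (X w) a) u.
  exact: dotv_differentiable.
have phi0 v : 'D_v (fun w => dotv (X w) a) u = 0.
  by rewrite derive_dotv_cst 1?dotvC ?aX //; exact: diff_derivable.
have := critical_littleo dX iX dphi phi0 e0.
by apply: filterS => w /=; rewrite -dotvBl dotvC.
Qed.

(** Along the ray in direction [v], dividing by h^2 bounds (a . Q)^2 by e (Q . Q), where Q is the
    difference quotient tending to the derivative; for small [e] this excludes a nonzero limit of a
    . Q. *)
Lemma conormal_derive {V : normedModType R} {n} (X : V -> 'rV[R]_n) u a v :
  differentiable X u -> conormal X u a -> dotv a ('D_v X u) = 0.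
Proof.
move=> dX ca; have dXv := diff_derivable (v := v) dX.
set s := dotv a _; apply/eqP; apply: contraT => s0.
have ds : is_derive u v (fun w => dotv (X w) a) s.
  apply: (DeriveDef _); last by rewrite derive_dotv_cst // dotvC.
  by have [] := is_derive_dotv dXv (derivable_cst a u v).
set D := 'D_v X u in s s0 ds *.
have cX : (fun h => h^-1 *: (X (h *: v + u) - X u)) @ 0^' --> D by exact: dXv.
have cs : (fun h => h^-1 *: (dotv (X (h *: v + u)) a - dotv (X u) a)) @ 0^' --> s.
  by have [d1 <-] := ds; exact: d1.
(* [K] bounds Q . Q for every Q within 1 of [D], and [e] makes e K half of (|s| / 2)^2, a lower
   bound for (a . Q)^2 near the limit. *)
pose K := n%:R * ((`|D| + 1) * (`|D| + 1)) + 1.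
have K0 : 0 < K by rewrite ltr_wpDl // mulr_ge0 // mulr_ge0 // addr_ge0.
have s20 : 0 < `|s| / 2 by rewrite divr_gt0 // normr_gt0.
pose e := (`|s| / 2) ^+ 2 / (2 * K).
have e0 : 0 < e by rewrite divr_gt0 ?exprn_gt0 // mulr_gt0.
have hc : {for (0:R), continuous (fun h : R => h *: v + u)}.
  move=> /=; apply: cvgD; last exact: cvg_cst.
  exact: scalel_continuous.
have nearh : \forall h \near (0:R)^',
    dotv a (X (h *: v + u) - X u) ^+ 2 <=
    e * dotv (X (h *: v + u) - X u) (X (h *: v + u) - X u).
  apply: nbhs_dnbhs.
  have cu : nbhs (0 *: v + u) [set w | dotv a (X w - X u) ^+ 2 <=
      e * dotv (X w - X u) (X w - X u)].
    by rewrite scale0r add0r; exact: ca.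
  exact: (hc _ cu).
suff [h [h0 hn H1 H2]] : exists h : R, [/\ h != 0,
    dotv a (X (h *: v + u) - X u) ^+ 2 <=
      e * dotv (X (h *: v + u) - X u) (X (h *: v + u) - X u),
    `|D - h^-1 *: (X (h *: v + u) - X u)| <= 1 &
    `|s - h^-1 *: (dotv (X (h *: v + u)) a - dotv (X u) a)| <= `|s| / 2].
  set Q := h^-1 *: (X (h *: v + u) - X u) in H1.
  have QE : X (h *: v + u) - X u = h *: Q by rewrite /Q scalerA mulfV // scale1r.
  have Qn : `|Q| <= `|D| + 1.
    rewrite -[Q](subrK D) addrC; apply: le_trans (ler_normD _ _) _.
    by rewrite lerD2l distrC.
  rewrite -dotvBl QE dotvZl scalerA mulVf // scale1r in H2.
  have {}hn : dotv a Q ^+ 2 <= e * dotv Q Q.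
    have h2 : 0 < h ^+ 2 by rewrite exprn_even_gt0.
    by rewrite -(ler_pM2l h2); move: hn; rewrite QE !(dotvZl, dotvZr); lra.
  have QQ : dotv Q Q <= K.
    apply: le_trans (ler_norm _) _; apply: le_trans (dotv_le_norm _ _) _.
    by rewrite ler_wpDr // ler_wpM2l // ler_pM.
  have : `|s| / 2 <= `|dotv a Q|.
    rewrite dotvC; have := ler_normD (dotv Q a) (s - dotv Q a).
    rewrite addrC subrK; lra.
  move=> sQ; have : (`|s| / 2) ^+ 2 <= dotv a Q ^+ 2.
    by rewrite -[leRHS]real_normK ?num_real // ler_sqr // nnegrE // ltW.
  move=> /le_trans /(_ hn).
  have : e * dotv Q Q <= (`|s| / 2) ^+ 2 / 2.
    rewrite -(ler_pM2l e0) in QQ; apply: le_trans QQ _.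
    by rewrite /e invfM mulrA divfK // gt_eqF.
  have : 0 < (`|s| / 2) ^+ 2 by rewrite exprn_gt0.
  lra.
apply: (@filter_ex _ (0:R)^').
near=> h; split.
- by near: h; exact: nbhs_dnbhs_neq.
- by near: h.
- by near: h; move/cvgrPdist_le : cX; apply.
- by near: h; move/cvgrPdist_le : cs; apply.
Unshelve. all: by end_near. Qed.

End FirstOrder.

(** * Second derivatives *)

Section Schwarz.
Context {R : realType} {V : normedModType R}.
Implicit Types (phi : V -> R) (x v w u : V).

Lemma is_derive_line phi x v (t df : R) : is_derive (x + t *: v) v phi df ->
  is_derive t 1 (fun s : R => phi (x + s *: v)) df.
Proof.
have E : (fun h : R => h^-1 *: (phi (x + (h *: 1 + t) *: v) - phi (x + t *: v))) =
         (fun h => h^-1 *: (phi (h *: v + (x + t *: v)) - phi (x + t *: v))).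
  apply/funext => h; rewrite scalerDl [h *: 1]mulr1.
  by rewrite addrCA.
by move=> [dphi <-]; split; rewrite /derivable /derive /= E.
Qed.

Lemma is_derive_translate phi x v k (df : R) : is_derive (x + k) v phi df ->
  is_derive x v (fun y => phi (y + k)) df.
Proof.
have E : (fun h : R => h^-1 *: (phi (h *: v + x + k) - phi (x + k))) =
         (fun h => h^-1 *: (phi (h *: v + (x + k)) - phi (x + k))).
  by apply/funext => h; rewrite addrA.
by move=> [dphi <-]; split; rewrite /derivable /derive /= E.
Qed.

Lemma line_MVT phi dphi x v (h : R) : 0 < h ->
  (forall t, 0 <= t <= h -> is_derive (x + t *: v) v phi (dphi (x + t *: v))) ->
  exists2 c, 0 <= c <= h &
    phi (x + h *: v) - phi x = h * dphi (x + c *: v).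
Proof.
move=> h0 dP; pose g (t : R) := phi (x + t *: v).
have gP t : 0 <= t <= h -> is_derive t 1 g (dphi (x + t *: v)).
  by move=> /dP; exact: is_derive_line.
have [t||c] := @MVT _ g (fun t => dphi (x + t *: v)) 0 h h0.
- by rewrite in_itv /= => /andP[t0 th]; apply: gP; rewrite !ltW.
- apply: derivable_within_continuous => t; rewrite in_itv /= => th.
  by have [] := gP t th.
rewrite in_itv /= => /andP[c0 ch]; rewrite subr0 /g scale0r addr0 mulrC => E.
by exists c => //; rewrite !ltW.
Qed.

(** The mean value theorem is used twice: along [v] for the increment of [phi] in direction [w],
    then along [w] for [phiv]. The second difference on the left is symmetric in the two
    directions. *)
Lemma mixed_difference phi phiv phivw u v w (h : R) : 0 < h ->
  (forall s t, 0 <= s <= h -> 0 <= t <= h ->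
     let x := u + s *: v + t *: w in
     is_derive x v phi (phiv x) /\ is_derive x w phiv (phivw x)) ->
  exists s t, [/\ 0 <= s <= h, 0 <= t <= h &
    phi (u + h *: v + h *: w) - phi (u + h *: v) - phi (u + h *: w) + phi u =
    h ^+ 2 * phivw (u + s *: v + t *: w)].
Proof.
move=> h0 dP; pose g x := phi (x + h *: w) - phi x.
have h0h : 0 <= h <= h by rewrite lexx ltW.
have [s sh|s sh E1] := @line_MVT g (fun x => phiv (x + h *: w) - phiv x) u v h h0.
  have /= [d1 _] := dP s h sh h0h.
  have /= [] := dP s 0 sh; first by rewrite lexx ltW.
  rewrite scale0r addr0 => d2 _.
  by apply: is_deriveB; exact: is_derive_translate.
have [t th|t th E2] := @line_MVT phiv phivw (u + s *: v) w h h0.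
  by have [] := dP s t sh th.
exists s, t; split=> //.
rewrite expr2 -mulrA -E2 -E1 /g (addrAC u); ring.
Qed.

(** Both mixed derivatives, at suitable points of a small box, equal the same second difference
    divided by h^2; continuity at [u] does the rest. *)
Lemma schwarz phi phiv phiw phivw phiwv (U : set V) u v w :
  nbhs u U ->
  (forall x, U x -> is_derive x v phi (phiv x)) ->
  (forall x, U x -> is_derive x w phi (phiw x)) ->
  (forall x, U x -> is_derive x w phiv (phivw x)) ->
  (forall x, U x -> is_derive x v phiw (phiwv x)) ->
  {for u, continuous phivw} -> {for u, continuous phiwv} ->
  phivw u = phiwv u.
Proof.
move=> Uu dv dw dvw dwv cvw cwv; apply/eqP; rewrite -subr_eq0 -normr_le0.
apply/ler_addgt0Pr => e e0; rewrite add0r.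
have e20 : 0 < e / 2 by rewrite divr_gt0.
pose P x := [/\ U x, `|phivw u - phivw x| <= e / 2 &
                     `|phiwv u - phiwv x| <= e / 2].
have /nbhs_ballP[d /= d0 dP] : nbhs u P.
  near=> x; split.
  - by near: x.
  - by near: x; move/cvgrPdist_le : cvw; apply.
  - by near: x; move/cvgrPdist_le : cwv; apply.
(* Keeps the box within d / 2 of [u]; the 1 avoids a zero denominator when [v] and [w] vanish. *)
pose h := d / (2 * (`|v| + `|w| + 1)).
have N0 : 0 < `|v| + `|w| + 1 by rewrite ltr_wpDl // addr_ge0.
have h0 : 0 < h by rewrite divr_gt0 // mulr_gt0.
have box s t : 0 <= s <= h -> 0 <= t <= h -> P (u + s *: v + t *: w).
  move=> /andP[s0 sh] /andP[t0 th]; apply: dP; rewrite /= -ball_normE /ball_ /=.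
  rewrite -addrA opprD addrA subrr sub0r normrN.
  apply: le_lt_trans (ler_normD _ _) _; rewrite !normrZ !ger0_norm //.
  apply: (@le_lt_trans _ _ (h * (`|v| + `|w| + 1))).
    rewrite mulrDr mulr1 mulrDr -[leLHS]addr0 lerD ?(ltW h0) //.
    by rewrite lerD // ler_wpM2r.
  by rewrite /h invfM mulrA divfK ?gt_eqF // ltr_pdivrMr // mulr_natr mulr2n ltrDl.
have [s t sh th|s [t [sh th E1]]] :=
    @mixed_difference phi phiv phivw u v w h h0.
  by move=> /=; have [Ux _ _] := box s t sh th; split; [exact: dv|exact: dvw].
have [s' t' sh' th'|s' [t' [sh' th' E2]]] :=
    @mixed_difference phi phiw phiwv u w v h h0.
  rewrite /= (addrAC u); have [Ux _ _] := box t' s' th' sh'.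
  by split; [exact: dw|exact: dwv].
have [_ H1 _] := box s t sh th; have [_ _ H2] := box t' s' th' sh'.
have E : phivw (u + s *: v + t *: w) = phiwv (u + t' *: v + s' *: w).
  apply: (mulfI (_ : h ^+ 2 != 0)); first by rewrite expf_neq0 // gt_eqF.
  by rewrite -E1 (addrAC u (t' *: v)) -E2 (addrAC u (h *: w)); ring.
have -> : phivw u - phiwv u = (phivw u - phivw (u + s *: v + t *: w)) -
    (phiwv u - phiwv (u + t' *: v + s' *: w)) by rewrite E; ring.
by apply: le_trans (ler_normB _ _) _; lra.
Unshelve. all: by end_near. Qed.

End Schwarz.

(** * Minimal surfaces along geodesics *)

Section Frames.
Context {R : realType}.

Definition orthonormal4 (a n b c : 'rV[R]_4) : Prop :=
  [/\ dotv a a = 1, dotv n n = 1, dotv b b = 1 & dotv c c = 1] /\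
  [/\ dotv a n = 0, dotv a b = 0, dotv a c = 0 &
      [/\ dotv n b = 0, dotv n c = 0 & dotv b c = 0]].

Definition frame_mx (a n b c : 'rV[R]_4) : 'M[R]_4 :=
  \matrix_i (nth 0 [:: a; n; b; c] i : 'rV[R]_4).

Lemma frame_mx_tr (a n b c x : 'rV[R]_4) i :
  (frame_mx a n b c *m x^T) i 0 = dotv (nth 0 [:: a; n; b; c] i) x.
Proof. by rewrite mxE; apply: eq_bigr => j _; rewrite !mxE. Qed.

Lemma frame_mx_orthogonal (a n b c : 'rV[R]_4) : orthonormal4 a n b c ->
  frame_mx a n b c *m (frame_mx a n b c)^T = 1%:M.
Proof.
move=> [[aa nn bb cc] [an ab ac [nb nc bc]]].
apply/matrixP => i j; rewrite [RHS]mxE.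
have -> : (frame_mx a n b c *m (frame_mx a n b c)^T) i j =
    dotv (nth 0 [:: a; n; b; c] i) (nth 0 [:: a; n; b; c] j).
  by rewrite mxE; apply: eq_bigr => k _; rewrite !mxE.
by case: i => [[|[|[|[|i]]]] Hi] //; case: j => [[|[|[|[|j]]]] Hj] //=;
  rewrite // dotvC.
Qed.

Lemma parseval4 (a n b c x y : 'rV[R]_4) : orthonormal4 a n b c ->
  dotv x y = dotv a x * dotv a y + dotv n x * dotv n y +
             dotv b x * dotv b y + dotv c x * dotv c y.
Proof.
move=> /frame_mx_orthogonal/mulmx1C MM; set M := frame_mx a n b c in MM.
have -> : dotv x y = ((M *m x^T)^T *m (M *m y^T)) 0 0.
  by rewrite trmx_mul trmxK mulmxA -(mulmxA x) MM mulmx1 dotv_mx.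
rewrite mxE; under eq_bigr => i _ do rewrite mxE !frame_mx_tr.
by rewrite !big_ord_recl big_ord0 /= addr0 !addrA.
Qed.

Lemma orthonormal4_eq0 (a n b c x : 'rV[R]_4) : orthonormal4 a n b c ->
  dotv a x = 0 -> dotv n x = 0 -> dotv b x = 0 -> dotv c x = 0 -> x = 0.
Proof.
move=> H ax nx bx cx; apply: dotv_eq0.
by rewrite (parseval4 x x H) ax nx bx cx !mul0r !addr0.
Qed.

End Frames.

Lemma derive_near_cst {R : realType} {V : normedModType R} (f : V -> R) x v k :
  (\forall y \near x, f y = k) -> 'D_v f x = 0.
Proof.
move=> fk; rewrite (@near_eq_derive R V R f (fun=> k)) //.
exact: derive_cst.
Qed.

Lemma dotv_continuous {R : realType} {T : topologicalType} {n}
    (F G : T -> 'rV[R]_n) x : {for x, continuous F} -> {for x, continuous G} ->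
  {for x, continuous (fun y => dotv (F y) (G y))}.
Proof.
move=> cF cG; rewrite /continuous_at /dotv.
apply: (cvg_big _ (nbhs_filter x)) => [|i _]; first exact: add_continuous.
apply: (@cvgM _ _ _ (nbhs_filter x)).
  exact: (continuous_comp cF (@coord_continuous _ _ _ 0 i _)).
exact: (continuous_comp cG (@coord_continuous _ _ _ 0 i _)).
Qed.

(** * The shape operator of a minimal surface *)

Section ShapeOperator.
Context {R : realType}.
Variables (X N : 'rV[R]_2 -> 'rV[R]_4) (U : set 'rV[R]_2) (u : 'rV[R]_2).
Hypotheses (Uo : open U) (Uu : U u) (X2 : class_C 2 U X).
Hypothesis iX : forall v, 'D_v X u = 0 -> v = 0.
Hypothesis dN : differentiable N u.
Hypothesis XX : forall w, U w -> dotv (X w) (X w) = 1.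
Hypothesis NN : \forall w \near u, dotv (N w) (N w) = 1.
Hypothesis NX : \forall w \near u, dotv (N w) (X w) = 0.
Hypothesis NdX : forall v, \forall w \near u, dotv (N w) ('D_v X w) = 0.

Let dX w : U w -> differentiable X w.
Proof. by case: X2 => + _; apply. Qed.

Let ddX v w : U w -> differentiable (fun x => 'D_v X x) w.
Proof. by case: X2 => _ /(_ v) [+ _]; apply. Qed.

Let cddX v v' w : U w -> {for w, continuous (fun x => 'D_v ('D_v' X) x)}.
Proof. by case: X2 => _ /(_ v') [_ /(_ v)]; apply. Qed.

Lemma derive_sphere w v : U w -> dotv (X w) ('D_v X w) = 0.
Proof.
move=> Uw; have dXw := diff_derivable (v := v) (dX Uw).
have := derive_dotv dXw dXw.
have -> : 'D_v (fun y => dotv (X y) (X y)) w = 0.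
  apply: (@derive_near_cst _ _ _ _ _ 1).
  have Uw' : nbhs w U by exact: open_nbhs_nbhs.
  by apply: filterS Uw' => y; exact: XX.
by rewrite dotvC => ?; lra.
Qed.

Lemma derive_normal_unit v : dotv (N u) ('D_v N u) = 0.
Proof.
have dNu := diff_derivable (v := v) dN.
have := derive_dotv dNu dNu.
have -> : 'D_v (fun y => dotv (N y) (N y)) u = 0.
  exact: derive_near_cst NN.
by rewrite dotvC => ?; lra.
Qed.

Lemma derive_normal_position v : dotv (X u) ('D_v N u) = 0.
Proof.
have := derive_dotv (diff_derivable (v := v) dN) (diff_derivable (v := v) (dX Uu)).
have -> : 'D_v (fun y => dotv (N y) (X y)) u = 0.
  exact: derive_near_cst NX.
by rewrite (nbhs_singleton (NdX v)) addr0 dotvC.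
Qed.

Lemma weingarten v w :
  dotv ('D_v N u) ('D_w X u) = - dotv ('D_v ('D_w X) u) (N u).
Proof.
have := derive_dotv (diff_derivable (v := v) dN) (diff_derivable (v := v) (ddX w Uu)).
have -> : 'D_v (fun y => dotv (N y) ('D_w X y)) u = 0.
  exact: derive_near_cst (NdX w).
by rewrite (dotvC (N u)) => /esym/eqP; rewrite addr_eq0 => /eqP.
Qed.

Lemma second_derivative_sym v w a :
  dotv ('D_v ('D_w X) u) a = dotv ('D_w ('D_v X) u) a.
Proof.
have nU : nbhs u U by exact: open_nbhs_nbhs.
apply: (@schwarz _ _ (fun x => dotv (X x) a) (fun x => dotv ('D_w X x) a)
  (fun x => dotv ('D_v X x) a) (fun x => dotv ('D_v ('D_w X) x) a)
  (fun x => dotv ('D_w ('D_v X) x) a) U u w v) => //.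
- move=> x Ux; have d := diff_derivable (v := w) (dX Ux).
  by apply: DeriveDef; [have [] := is_derive_dotv d (derivable_cst a x w)|
                         exact: derive_dotv_cst].
- move=> x Ux; have d := diff_derivable (v := v) (dX Ux).
  by apply: DeriveDef; [have [] := is_derive_dotv d (derivable_cst a x v)|
                         exact: derive_dotv_cst].
- move=> x Ux; have d := diff_derivable (v := v) (ddX w Ux).
  by apply: DeriveDef; [have [] := is_derive_dotv d (derivable_cst a x v)|
                         exact: derive_dotv_cst].
- move=> x Ux; have d := diff_derivable (v := w) (ddX v Ux).
  by apply: DeriveDef; [have [] := is_derive_dotv d (derivable_cst a x w)|
                         exact: derive_dotv_cst].
- by apply: dotv_continuous; [exact: cddX|exact: cst_continuous].
- by apply: dotv_continuous; [exact: cddX|exact: cst_continuous].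
Qed.

Hypothesis H0 : mean_curvature X u = 0.

(** The position and tangential corrections in [second_form] are orthogonal to the normal, and
    [weingarten] turns the remaining second derivatives into derivatives of [N]. *)
Lemma mean_curvature_normal :
  \sum_(i < 2) \sum_(j < 2) invmx (gram X u) i j *
    dotv ('D_(delta_mx 0 i) N u) ('D_(delta_mx 0 j) X u) = 0.
Proof.
have := congr1 (fun x => dotv x (N u)) H0.
have XN : dotv (X u) (N u) = 0 by rewrite dotvC (nbhs_singleton NX).
have dXN v : dotv ('D_v X u) (N u) = 0.
  by rewrite dotvC (nbhs_singleton (NdX v)).
have dotv_suml n (F : 'I_n -> 'rV[R]_4) a :
    dotv (\sum_i F i) a = \sum_i dotv (F i) a.
  by rewrite dotv_mx mulmx_suml summxE; apply: eq_bigr => i _; rewrite dotv_mx.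
rewrite /mean_curvature dotvZl dotv0l => /eqP; rewrite mulf_eq0 invr_eq0.
rewrite (negPf (_ : 2 != 0)) ?pnatr_eq0 //= dotv_suml => /eqP E.
apply: oppr_inj; rewrite oppr0 -[RHS]E -sumrN; apply: eq_bigr => i _.
rewrite dotv_suml -sumrN; apply: eq_bigr => j _.
rewrite weingarten dotvZl mulrN opprK; congr (_ * _).
rewrite /second_form /partial !dotvBl dotvZl XN mulr0 subr0.
rewrite dotv_suml big1 ?subr0 // => k _; rewrite dotv_suml big1 // => l _.
by rewrite dotvZl dXN mulr0.
Qed.

Variables (b c : 'rV[R]_4).
Hypothesis frame : orthonormal4 (X u) (N u) b c.

(* The shape operator in the tangent frame (b, c): it is symmetric by
   Schwarz's theorem and trace-free by minimality. *)
Lemma shape_operator : exists p q, forall v,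
  dotv b ('D_v N u) = p * dotv b ('D_v X u) + q * dotv c ('D_v X u) /\
  dotv c ('D_v N u) = q * dotv b ('D_v X u) - p * dotv c ('D_v X u).
Proof.
pose d (i : 'I_2) : 'rV[R]_2 := delta_mx 0 i.
pose t (i : 'I_2) : 'rV[R]_4 := nth 0 [:: b; c] i.
(* The rows of [J] and [K] are the partial derivatives of [X] and [N] in the tangent frame; the
   matrix [S] with K = J S below expresses the derivative of [N] through that of [X]. *)
pose J : 'M[R]_2 := \matrix_(i, k) dotv (t k) ('D_(d i) X u).
pose K : 'M[R]_2 := \matrix_(i, k) dotv (t k) ('D_(d i) N u).
have JK (F : 'rV[R]_2 -> 'rV[R]_4) v a : differentiable F u ->
    dotv a ('D_v F u) = \sum_i v 0 i * dotv a ('D_(d i) F u).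
  move=> dF; rewrite deriveE // [v in LHS]row_sum_delta linear_sum.
  rewrite dotvC dotv_mx mulmx_suml summxE; apply: eq_bigr => i _.
  by rewrite linearZ /= -dotv_mx dotvZl dotvC deriveE.
have XdX v : dotv (X u) ('D_v X u) = 0 by exact: derive_sphere.
have NdXu v : dotv (N u) ('D_v X u) = 0 by exact: nbhs_singleton (NdX v).
have JX v k : (v *m J) 0 k = dotv (t k) ('D_v X u).
  by rewrite mxE (JK _ _ _ (dX Uu)); apply: eq_bigr => i _; rewrite mxE.
have KN v k : (v *m K) 0 k = dotv (t k) ('D_v N u).
  by rewrite mxE (JK _ _ _ dN); apply: eq_bigr => i _; rewrite mxE.
have Ju : J \in unitmx.
  rewrite -row_free_unit; apply: inj_row_free => v vJ; apply: iX.
  apply: (orthonormal4_eq0 frame) => //.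
    by have := JX v 0; rewrite vJ mxE.
  by have := JX v 1; rewrite vJ mxE.
have tE (x y : 'rV[R]_4) : dotv (X u) y = 0 -> dotv (N u) y = 0 ->
    dotv x y = \sum_k dotv (t k) x * dotv (t k) y.
  move=> Xy Ny; rewrite (parseval4 _ _ frame) Xy Ny !mulr0 !add0r.
  by rewrite !big_ord_recl big_ord0 addr0.
have GJ : gram X u = J *m J^T.
  apply/matrixP => i j; rewrite !mxE /partial tE //.
  by apply: eq_bigr => k _; rewrite !mxE.
have [S KS] : exists S, K = J *m S by exists (invmx J *m K); rewrite mulKVmx.
have BJ i j : dotv ('D_(d i) N u) ('D_(d j) X u) = (K *m J^T) i j.
  by rewrite tE // mxE; apply: eq_bigr => k _; rewrite !mxE.
have JTu : J^T \in unitmx by rewrite unitmx_tr.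
(* K J^T is minus the second fundamental form, symmetric because mixed derivatives commute. *)
have BT : (K *m J^T)^T = K *m J^T.
  apply/matrixP => i j; rewrite [LHS]mxE.
  apply: (etrans (esym (BJ j i))); apply: (etrans _ (BJ i j)).
  apply: (etrans (weingarten (d j) (d i))).
  apply: (etrans _ (esym (weingarten (d i) (d j)))).
  exact: (congr1 -%R (second_derivative_sym (d j) (d i) (N u))).
have SS : S^T = S.
  have : J *m (S^T *m J^T) = J *m (S *m J^T).
    by rewrite !mulmxA -[in RHS]KS -BT trmx_mul trmxK KS trmx_mul mulmxA.
  move/(can_inj (mulKmx Ju)); exact: (can_inj (mulmxK JTu)).
have GI : invmx (gram X u) = (invmx J)^T *m invmx J.
  have Gu : gram X u \in unitmx by rewrite GJ unitmx_mul Ju JTu.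
  apply: (can_inj (mulKmx Gu)); rewrite (mulmxV Gu) GJ mulmxA -(mulmxA J).
  by rewrite -trmx_mul (mulVmx Ju) trmx1 mulmx1 (mulmxV Ju).
(* Cycling the trace of J^-1 (K J^T) J^-T produces the contraction of the inverse metric with K J^T,
   which minimality makes zero. *)
have trS : \tr S = 0.
  rewrite -[RHS]mean_curvature_normal.
  have -> : S = invmx J *m K *m J^T *m invmx J^T by rewrite (mulmxK JTu) KS (mulKmx Ju).
  rewrite mxtrace_mulC -trmx_inv !mulmxA -GI -mulmxA /mxtrace.
  apply: eq_bigr => i _; rewrite [LHS]mxE; apply: eq_bigr => j _.
  by congr (_ * _); rewrite -[in LHS]BT [LHS]mxE -BJ.
exists (S 0 0), (S 0 1) => v.
have S10 : S 1 0 = S 0 1 by rewrite -[in LHS]SS mxE.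
have S11 : S 1 1 = - S 0 0.
  move: trS; rewrite /mxtrace !big_ord_recl big_ord0 addr0.
  have -> : lift ord0 ord0 = (1 : 'I_2) by exact/val_inj.
  by move/eqP; rewrite addrC addr_eq0 => /eqP.
have vK k : dotv (t k) ('D_v N u) =
    dotv b ('D_v X u) * S 0 k + dotv c ('D_v X u) * S 1 k.
  rewrite -KN KS mulmxA mxE !big_ord_recl big_ord0 addr0 !JX.
  by have -> : lift ord0 ord0 = (1 : 'I_2) by exact/val_inj.
by have := vK 0; have := vK 1; rewrite /t /= S10 S11 => -> ->; split; ring.
Qed.

End ShapeOperator.

Section Wedge.
Context {R : realType} {V : normedModType R}.
Variables (X N : V -> 'rV[R]_4) (u : V).
Hypotheses (dX : differentiable X u) (dN : differentiable N u).

Lemma wedge_differentiable : differentiable (fun w => wedge (X w) (N w)) u.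
Proof.
have dm i j : differentiable (fun w => minor (X w) (N w) i j) u.
  by apply: differentiableB; apply: differentiableM; exact: differentiable_entry.
apply: differentiable_rV => -[[|[|[|[|[|[|i]]]]]] Hi] //;
  under eq_fun do rewrite mxE /=; exact: dm.
Qed.

Lemma derive_wedge y z v :
  dotv (wedge y z) ('D_v (fun w => wedge (X w) (N w)) u) =
    dotv y ('D_v X u) * dotv z (N u) + dotv y (X u) * dotv z ('D_v N u) -
    dotv y ('D_v N u) * dotv z (X u) - dotv y (N u) * dotv z ('D_v X u).
Proof.
have dXv := diff_derivable (v := v) dX; have dNv := diff_derivable (v := v) dN.
have dc (F : V -> 'rV[R]_4) a : derivable F u v ->
    is_derive u v (fun w => dotv (F w) a) (dotv a ('D_v F u)).
  move=> dF; apply: DeriveDef; last by rewrite derive_dotv_cst // dotvC.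
  by have [] := is_derive_dotv dF (derivable_cst a u v).
rewrite dotvC -derive_dotv_cst; last exact/diff_derivable/wedge_differentiable.
have -> : (fun w => dotv (wedge (X w) (N w)) (wedge y z)) =
    (fun w => dotv (X w) y) * (fun w => dotv (N w) z) -
    (fun w => dotv (X w) z) * (fun w => dotv (N w) y).
  by apply/funext => w; rewrite dotv_wedge.
have Xy := dc X y dXv; have Xz := dc X z dXv.
have Ny := dc N y dNv; have Nz := dc N z dNv.
rewrite derive_val !(dotvC (X u)) !(dotvC (N u)) /GRing.scale /=; ring.
Qed.

End Wedge.

(* The point of the great circle through a and b at distance arcsin s from a. *)
Definition circle_pt {R : realType} {n} (a b : 'rV[R]_n) (s : R) : 'rV[R]_n :=
  Num.sqrt (1 - s ^+ 2) *: a + s *: b.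

(** * First-order behaviour along an edge *)

Section Edge.
Context {R : realType}.

Lemma sqrt_onemsq_bounds (s : R) : 0 <= s <= 1 ->
  [/\ 0 <= Num.sqrt (1 - s ^+ 2), Num.sqrt (1 - s ^+ 2) ^+ 2 = 1 - s ^+ 2 &
      (Num.sqrt (1 - s ^+ 2) - 1) ^+ 2 + s ^+ 2 <= 2 * s ^+ 2].
Proof.
move=> /andP[s0 s1]; have s2 : 0 <= 1 - s ^+ 2 by nra.
have r0 := sqrtr_ge0 (1 - s ^+ 2); have r2 := sqr_sqrtr s2.
by split=> //; nra.
Qed.

Lemma circle_pt_increment {n} (a b : 'rV[R]_n) (s : R) : dotv a a = 1 ->
  dotv b b = 1 -> dotv a b = 0 -> 0 <= s <= 1 ->
  dotv (circle_pt a b s - a) (circle_pt a b s - a) <= 2 * s ^+ 2.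
Proof.
move=> aa bb ab /sqrt_onemsq_bounds[_ _ H].
have -> : circle_pt a b s - a = (Num.sqrt (1 - s ^+ 2) - 1) *: a + s *: b.
  by rewrite /circle_pt scalerBl scale1r addrAC.
rewrite !(dotvDl, dotvDr, dotvZl, dotvZr) aa bb (dotvC b a) ab.
by apply: le_trans H; lra.
Qed.

(** Subtracting from [phi] its linear part gives a function [k] critical at [u]. At the edge points
    [phi] has its old value while the linear part has moved by p s, too much for a critical function
    unless p = 0. *)
Lemma edge_differential (X : 'rV[R]_2 -> 'rV[R]_4) phi u a b c (p q : R) :
  differentiable X u -> (forall v, 'D_v X u = 0 -> v = 0) ->
  differentiable phi u ->
  (forall v, 'D_v phi u = p * dotv b ('D_v X u) + q * dotv c ('D_v X u)) ->
  dotv a a = 1 -> dotv b b = 1 -> dotv a b = 0 -> dotv a c = 0 ->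
  dotv b c = 0 -> X u = a ->
  (forall P : set 'rV[R]_2, nbhs u P -> exists s w,
     [/\ 0 < s <= 1, P w, X w = circle_pt a b s & phi w = phi u]) ->
  p = 0.
Proof.
move=> dX iX dphi Dphi aa bb ab ac bc Xu edge.
pose k w := phi w - dotv (X w) (p *: b + q *: c).
have dXc a' : differentiable (fun w => dotv (X w) a') u.
  exact: dotv_differentiable.
have dk : differentiable k u by exact: differentiableB.
have k0 v : 'D_v k u = 0.
  rewrite [LHS](@deriveB _ _ _ phi (fun w => dotv (X w) (p *: b + q *: c)));
    try exact: diff_derivable.
  rewrite derive_dotv_cst; last exact: diff_derivable.
  by rewrite Dphi dotvDr !dotvZr !(dotvC ('D_v X u)) subrr.
apply/eqP; apply: contraT => p0.
(* The squared chord is at most 2 s^2, so this [e] allows only half of p^2 s^2. *)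
have e0 : 0 < p ^+ 2 / 4 by rewrite divr_gt0 // exprn_even_gt0.
have [s [w [/andP[s0 s1] /= H Xw phiw]]] := edge _ (critical_littleo dX iX dk k0 e0).
have kE : k w - k u = - (p * s).
  rewrite /k phiw Xw Xu /circle_pt !(dotvDl, dotvDr, dotvZl, dotvZr).
  by rewrite ab ac bc bb; ring.
have s01 : 0 <= s <= 1 by rewrite (ltW s0) s1.
have := circle_pt_increment aa bb ab s01.
move: H; rewrite kE Xw Xu sqrrN exprMn => H1 H2.
have p2 : 0 < p ^+ 2 by rewrite exprn_even_gt0.
have s2 : 0 < s ^+ 2 by rewrite exprn_gt0.
have : p ^+ 2 * s ^+ 2 <= p ^+ 2 / 4 * (2 * s ^+ 2).
  by apply: le_trans H1 _; rewrite ler_pM2l.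
have : 0 < p ^+ 2 * s ^+ 2 by rewrite mulr_gt0.
lra.
Qed.

End Edge.

(** * Surfaces and coverings *)

Section LocalEquality.

Lemma near_eq_continuous {T U : topologicalType} (f g : T -> U) x :
  {near x, f =1 g} -> {for x, continuous f} -> {for x, continuous g}.
Proof.
move=> E cf; have gx : f x = g x := nbhs_singleton E.
suff h : g @ x --> f x by move: h; rewrite gx.
by apply: cvg_trans cf; apply: near_eq_cvg; apply: filterS E.
Qed.

Lemma near_eq_differentiable {R : realType} {V W : normedModType R}
    (f g : V -> W) x :
  {near x, f =1 g} -> differentiable f x -> differentiable g x.
Proof.
move=> E df; have /diff_locallyP[dc /eqaddoP dE] := df.
pose L := 'd f x.
have gE : g \o shift x = cst (g x) + L +o_ (0 : V) id.
  apply/eqaddoP => e e0.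
  have E0 : \forall h \near (0 : V), f (h + x) = g (h + x).
    have := E; rewrite (near_shift (0 : V)) /= subr0.
    by apply.
  move: (dE e e0); apply: filterS2 E0 => h.
  by rewrite !fctE /= => -> ; rewrite (nbhs_singleton E : f x = g x).
apply/diff_locallyP; split.
  by rewrite (diff_unique dc gE).
by rewrite (diff_unique dc gE).
Qed.

End LocalEquality.

Section Charts.
Context {R : realType} (M : surface R).
Implicit Types (x : M) (c : chart (R := R) M).

Lemma chartP c : charts c -> is_chart c.
Proof. by move: c; case: (atlasP (surface_structure M)). Qed.

Lemma chart_at x : exists2 c, charts c & chart_dom c x.
Proof. by case: (atlasP (surface_structure M)) => _ + _; apply. Qed.

Lemma chart_nbhs c x : charts c -> chart_dom c x -> nbhs x (chart_dom c).
Proof. by move=> /chartP[oc _ _ _ _] cx; exact: open_nbhs_nbhs. Qed.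

Lemma chart_codP c x : chart_dom c x -> chart_cod c (chart_map c x).
Proof. by move=> cx; exists x. Qed.

Lemma chart_open c : charts c -> open (chart_cod c).
Proof. by move=> /chartP[]. Qed.

Lemma chart_cod_nbhs c x : charts c -> chart_dom c x ->
  nbhs (chart_map c x) (chart_cod c).
Proof.
by move=> /chart_open oc cx; apply: open_nbhs_nbhs; split=> //; exists x.
Qed.

Lemma chart_mapK c x : charts c -> chart_dom c x ->
  chart_inv c (chart_map c x) = x.
Proof. by move=> /chartP[_ _ _ _ K] cx; apply: K; exact: mem_set. Qed.

Lemma chart_inv_dom c w : charts c -> chart_cod c w -> chart_dom c (chart_inv c w).
Proof. by move=> cc [x cx <-]; rewrite chart_mapK. Qed.

Lemma chart_invK c w : charts c -> chart_cod c w ->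
  chart_map c (chart_inv c w) = w.
Proof. by move=> cc [x cx <-]; rewrite chart_mapK. Qed.

Lemma chart_map_continuous c x : charts c -> chart_dom c x ->
  {for x, continuous (chart_map c)}.
Proof. by move=> /chartP[_ _ + _ _] cx; apply; exact: mem_set. Qed.

Lemma chart_inv_continuous c w : charts c -> chart_cod c w ->
  {for w, continuous (chart_inv c)}.
Proof. by move=> /chartP[_ _ _ + _] cx; apply; exact: mem_set. Qed.

End Charts.

Section VectorMaps.
Context {R : realType} {M : surface R} {n : nat}.
Implicit Types (F : M -> 'rV[R]_n.+1).

Lemma smooth_vector_map_continuous F x :
  smooth_vector_map F -> {for x, continuous F}.
Proof.
move=> sF; have [c cc cx] := chart_at x.
have cF : {for chart_map c x, continuous (F \o chart_inv c)}.
  exact: (sF c cc 0%N _ (chart_codP cx)).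
have h := continuous_comp (chart_map_continuous cc cx) cF.
apply: near_eq_continuous h.
by apply: filterS (chart_nbhs cc cx) => y cy /=; rewrite chart_mapK.
Qed.

Lemma smooth_vector_map_differentiable F c x :
  smooth_vector_map F -> charts c -> chart_dom c x ->
  differentiable (F \o chart_inv c) (chart_map c x).
Proof. by move=> sF cc cx; have [+ _] := sF c cc 1%N; apply; exact: chart_codP. Qed.

End VectorMaps.

Section Coverings.
Context {R : realType}.

Lemma id_covering (M : surface R) : smooth_covering (fun x : M => x).
Proof.
have sid : smooth_map_on [set: M] (fun x : M => x).
  split=> [x _|c d cc cd]; first exact: cvg_id.
  have [_ _ /(_ c d cc cd)] := atlasP (surface_structure M).
  by rewrite setTI.
split=> [y|y]; first by exists y.
exists setT; split=> //; first exact: openT.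
exists [set setT]; split=> [U ->|U U' -> -> //|].
  by split; [exact: openT|split=> //; exists (fun x => x); split].
by rewrite bigcup_set1.
Qed.

(** In the orientable case the two points of the fibre coincide, so both cases can be treated
    alike. *)
Lemma orientation_coverP (M Mbar : surface R) (p : Mbar -> M) :
  orientation_cover p ->
  smooth_covering p /\ forall y, exists x1 x2, p @^-1` [set y] = [set x1; x2].
Proof.
case=> [_|Mbar' p' _ [_ cp fp]].
  split=> [|y]; first exact: id_covering.
  by exists y, y; apply/seteqP; split=> x /=; [left|case].
by split=> // y; have [x1 [x2 [_ ?]]] := fp y; exists x1, x2.
Qed.

Definition local_section (M N : surface R) (p : M -> N) (x : M)
    (G : N -> M) : Prop :=
  [/\ G (p x) = x /\ {for x, continuous p}, {for p x, continuous G},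
      (\forall y \near p x, p (G y) = y), (\forall z \near x, G (p z) = z) &
      forall c d, charts c -> charts d -> chart_dom c (p x) -> chart_dom d x ->
        differentiable (chart_map d \o G \o chart_inv c) (chart_map c (p x)) /\
        differentiable (chart_map c \o p \o chart_inv d) (chart_map d x)].

Lemma chart_inv_cvg (M : surface R) (c : chart M) x :
  charts c -> chart_dom c x -> chart_inv c @ chart_map c x --> x.
Proof.
move=> cc cx; rewrite -[X in _ --> X](chart_mapK cc cx).
exact: chart_inv_continuous cc (chart_codP cx).
Qed.

Lemma section_chart_cvg (M N : surface R) (p : M -> N) x G (c : chart N) :
  charts c -> chart_dom c (p x) -> G (p x) = x -> {for p x, continuous G} ->
  G \o chart_inv c @ chart_map c (p x) --> x.
Proof.
move=> cc cpx Gx cG; have cGx : G @ p x --> x by rewrite -[X in _ --> X]Gx; exact: cG.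
exact: cvg_comp (chart_inv_cvg cc cpx) cGx.
Qed.

Lemma covering_section (M N : surface R) (p : M -> N) (x : M) :
  smooth_covering p -> exists G, local_section p x G.
Proof.
move=> [_ /(_ (p x))[V [oV Vpx [sh [shU shD shE]]]]].
have : (p @^-1` V) x by [].
rewrite shE => -[U Ush Ux]; have [oU [[cp sp] [G [[cG sG] GU GV]]]] := shU U Ush.
have GpU z : U z -> G (p z) = z by move=> /GU[].
have pGV y : V y -> p (G y) = y by move=> /GV[].
exists G; split.
- by split; [exact: GpU|exact: cp].
- exact: cG.
- have nV : nbhs (p x) V by exact: open_nbhs_nbhs.
  by apply: filterS nV => y; exact: pGV.
- have nU : nbhs x U by exact: open_nbhs_nbhs.
  by apply: filterS nU => y; exact: GpU.
- move=> c d cc cd cpx dx; split.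
    have [+ _] := sG c d cc cd 1%N; apply.
    by exists (p x) => //; split; [split|rewrite /= GpU].
  by have [+ _] := sp d c cd cc 1%N; apply; exists x.
Qed.

(** Every sheet over [V] meets the fibre over [y], so it is the sheet of [x1] or of [x2], and each
    point over a nearby [y'] lies in one of these two. Control of the whole fibre is what makes the
    absence of certain lifts an open condition. *)
Lemma covering_fiber_near (M N : surface R) (p : M -> N) y x1 x2 (W : set M) :
  smooth_covering p -> p @^-1` [set y] = [set x1; x2] ->
  nbhs x1 W -> nbhs x2 W ->
  \forall y' \near y, forall x', p x' = y' -> W x'.
Proof.
move=> [_ /(_ y)[V [oV Vy [sh [shU shD shE]]]]] fib W1 W2.
have nV : nbhs y V by exact: open_nbhs_nbhs.
have sheet x : p x = y -> nbhs x W -> exists U G, [/\ sh U, U x,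
    forall z, U z -> G (p z) = z & \forall y' \near y, W (G y')].
  move=> px Wx; have : (p @^-1` V) x by rewrite /= px.
  rewrite shE => -[U Ush Ux]; exists U.
  have [_ [_ [G [[cG _] GU _]]]] := shU U Ush; exists G; split=> //.
    by move=> z /GU[].
  have Gy : G y = x by rewrite -px; have [] := GU x Ux.
  have cGx : G @ y --> x by rewrite -[X in _ --> X]Gy; exact: cG.
  exact: (cGx _ Wx).
have in_fib x : p x = y -> x = x1 \/ x = x2.
  by move=> px; have : (p @^-1` [set y]) x by []; rewrite fib.
have px1 : p x1 = y by have : (p @^-1` [set y]) x1 by rewrite fib; left.
have px2 : p x2 = y by have : (p @^-1` [set y]) x2 by rewrite fib; right.
have [U1 [G1 [sh1 U1x K1 n1]]] := sheet x1 px1 W1.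
have [U2 [G2 [sh2 U2x K2 n2]]] := sheet x2 px2 W2.
near=> y' => x' px'.
have Vy' : V y' by near: y'.
have : (p @^-1` V) x' by rewrite /= px'.
rewrite shE => -[U Ush Ux'].
have [_ [_ [G [_ _ GV]]]] := shU U Ush.
have [UG pG] := GV y Vy.
have [Gx|Gx] := in_fib _ pG; rewrite Gx in UG.
  have UE : U = U1 by apply: shD => //; exists x1.
  by rewrite -(K1 x') -?UE // px'; near: y'.
have UE : U = U2 by apply: shD => //; exists x2.
by rewrite -(K2 x') -?UE // px'; near: y'.
Unshelve. all: by end_near. Qed.

Lemma covering_lift_near (M N : surface R) (p : M -> N) x (W : set M) :
  smooth_covering p -> nbhs x W ->
  \forall y \near p x, exists2 z, p z = y & W z.
Proof.
move=> cp Wx; have [G [[Gx _] cG pG _ _]] := covering_section x cp.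
have cGx : G @ p x --> x by rewrite -[X in _ --> X]Gx; exact: cG.
by apply: filterS2 pG (cGx _ Wx) => y pGy WG; exists (G y).
Qed.

End Coverings.

Section LocalPicture.
Context {R : realType} {M Mbar : surface R} {n : nat}.
Variables (p : Mbar -> M) (F : M -> 'rV[R]_n.+1) (nu : Mbar -> 'rV[R]_n.+1).
Hypotheses (cp : smooth_covering p) (sF : smooth_vector_map F).
Hypothesis (gnu : gauss_map (fun x => F (p x)) nu).

(** The Gauss condition is stated in charts of the cover, minimality in charts of the base; the
    chain rule through a local section of [p] carries the former down. *)
Lemma gauss_map_base x c v : charts c -> chart_dom c (p x) ->
  dotv (nu x) ('D_v (F \o chart_inv c) (chart_map c (p x))) = 0.
Proof.
move=> cc cpx; have [G [[Gx cpt] cG pG Gp dG]] := covering_section x cp.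
have [d cd dx] := chart_at x; have [dGcd dpcd] := dG c d cc cd cpx dx.
set u := chart_map c (p x); set w := chart_map d x.
have ciu : chart_inv c u = p x by rewrite chart_mapK.
have diw : chart_inv d w = x by rewrite chart_mapK.
have dFp : differentiable ((F \o p) \o chart_inv d) w.
  have dF : differentiable (F \o chart_inv c)
      ((chart_map c \o p \o chart_inv d) w).
    by rewrite /= diw; exact: smooth_vector_map_differentiable.
  apply: near_eq_differentiable (differentiable_comp dpcd dF).
  have near_c : \forall z \near w, chart_dom c (p (chart_inv d z)).
    have h := cvg_comp _ _ (chart_inv_cvg cd dx) cpt.
    exact: (h _ (chart_nbhs cc cpx)).
  by apply: filterS near_c => z cz /=; rewrite chart_mapK.
have FE : {near u, ((F \o p) \o chart_inv d) \o (chart_map d \o G \o chart_inv c)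
    =1 F \o chart_inv c}.
  have near_V : \forall z \near u, p (G (chart_inv c z)) = chart_inv c z.
    exact: (chart_inv_cvg cc cpx pG).
  have near_d : \forall z \near u, chart_dom d (G (chart_inv c z)).
    exact: (section_chart_cvg cc cpx Gx cG (chart_nbhs cd dx)).
  by apply: filterS2 near_V near_d => z pz dz /=; rewrite chart_mapK // pz.
have wE : (chart_map d \o G \o chart_inv c) u = w by rewrite /= ciu Gx.
have dFp' : differentiable ((F \o p) \o chart_inv d)
    ((chart_map d \o G \o chart_inv c) u) by rewrite wE.
rewrite -(near_eq_derive _ FE) deriveE; last exact: differentiable_comp.
rewrite diff_comp //= ciu Gx -/w -deriveE //.
by have [_ _ _ /(_ d w cd (chart_codP dx))] := gnu; rewrite diw; apply.
Qed.

Lemma gauss_map_differentiable x c G : charts c -> chart_dom c (p x) ->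
  local_section p x G ->
  differentiable (nu \o G \o chart_inv c) (chart_map c (p x)).
Proof.
move=> cc cpx [[Gx cpt] cG pG Gp dG]; have [d cd dx] := chart_at x.
have [dGcd _] := dG c d cc cd cpx dx; set u := chart_map c (p x).
have [snu _ _ _] := gnu.
have ciu : chart_inv c u = p x by rewrite chart_mapK.
have dnu : differentiable (nu \o chart_inv d)
    ((chart_map d \o G \o chart_inv c) u).
  by rewrite /= ciu Gx; exact: smooth_vector_map_differentiable.
apply: near_eq_differentiable (differentiable_comp dGcd dnu).
have near_d : \forall z \near u, chart_dom d (G (chart_inv c z)).
  exact: (section_chart_cvg cc cpx Gx cG (chart_nbhs cd dx)).
by apply: filterS near_d => z dz /=; rewrite chart_mapK.
Qed.

End LocalPicture.

(** * The Lawson surface *)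

Section LawsonSpace.
Context {R : realType}.
Variables (Gamma : polygon R) (f : 'rV[R]_2 -> 'rV[R]_4).
Local Notation S := (lawson_space Gamma f).
Local Notation G := (reflection_group Gamma).

Definition point_of (g : G) (q : @closed_disk R) : S :=
  (\pi_({eq_quot lawson_equiv Gamma f})%qT ((g, q) : lawson_pieces Gamma)).

Lemma lawson_map_point g q : lawson_map (point_of g q) = act (val g) (f (val q)).
Proof. exact: lawson_mapE. Qed.

Lemma point_of_surj (x : S) : exists g q, x = point_of g q.
Proof.
exists (repr (x : {eq_quot lawson_equiv Gamma f}%qT)).1.
exists (repr (x : {eq_quot lawson_equiv Gamma f}%qT)).2.
by rewrite /point_of -surjective_pairing reprK.
Qed.

Lemma point_of_continuous g : continuous (point_of g).
Proof.
move=> q; pose i (q : @closed_disk R) : lawson_pieces Gamma := (g, q).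
have ci : {for q, continuous i}.
  move=> B [[B1 B2] /= [n1 n2] sB]; apply: filterS n2 => q' Bq'.
  by apply: sB; split => //=; exact: nbhs_singleton n1.
exact: (continuous_comp ci (@pi_continuous _ _ _)).
Qed.

Lemma reflection_group1 : G 1.
Proof. by case: (generated_subgroup (reflections Gamma)). Qed.

Lemma reflection_groupM g h : G g -> G h -> G (g * h).
Proof. by case: (generated_subgroup (reflections Gamma)) => _ + _; apply. Qed.

Lemma group_reflection e r : Gamma e -> is_reflection e r -> G r.
Proof. by move=> Ge er H [_]; apply; exists e. Qed.

Definition group_elt g (Hg : G g) : G := exist _ g (mem_set Hg).

(** This is the gluing along an edge: its reflection belongs to the local group of each of its
    points. *)
Lemma point_of_reflection e r (Hr : G r) q : Gamma e -> is_reflection e r ->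
  edge_arc e (f (val q)) -> point_of (group_elt reflection_group1) q = point_of (group_elt Hr) q.
Proof.
move=> Ge er eq; apply/eqmodP/asboolP; rewrite /piece_elt /piece_pt /=.
have loc : local_group Gamma (f (val q)) r.
  by move=> H [_]; apply; exists e.
by rewrite act1 (local_group_fix loc) invr1 mul1r.
Qed.

(** The map to the sphere may have self-intersections, so a symmetry of the image has to be lifted
    to the quotient. The lift is defined on a chosen representative; [translate_point] removes the
    choice. *)
Definition translate h (Hh : G h) (x : S) : S :=
  let y := repr (x : {eq_quot lawson_equiv Gamma f}%qT) in
  point_of (group_elt (reflection_groupM Hh (set_mem (valP y.1)))) y.2.

(** Left multiplication by [h] preserves both conditions of the gluing relation: equality of image
    points, and the product of the inverse of one group element with the other. *)
Lemma translate_point h (Hh : G h) g (Hg : G g) q :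
  translate Hh (point_of (group_elt Hg) q) = point_of (group_elt (reflection_groupM Hh Hg)) q.
Proof.
rewrite /translate; set y := repr _.
have : lawson_rel f y (group_elt Hg, q).
  by have /eqmodP := reprK (point_of (group_elt Hg) q : {eq_quot lawson_equiv Gamma f}%qT).
move=> /asboolP[yE yl]; apply/eqmodP/asboolP.
rewrite /piece_elt /piece_pt /= in yE yl *; split; first by rewrite !actM yE.
have uh : h \is a GRing.unit by exact: generated_unit Hh.
have uy : val y.1 \is a GRing.unit.
  by apply: (@generated_unit _ Gamma); exact: set_mem (valP y.1).
by rewrite invrM // -mulrA mulKr.
Qed.

Lemma lawson_map_translate h (Hh : G h) x :
  lawson_map (translate Hh x) = act h (lawson_map x).
Proof.
by rewrite /translate lawson_map_point /= actM -lawson_map_point /point_of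
  -surjective_pairing reprK.
Qed.

Lemma group_elt_val (g : G) : group_elt (set_mem (valP g)) = g.
Proof. exact: val_inj. Qed.

Lemma translate_continuous h (Hh : G h) : continuous (translate Hh).
Proof.
apply/quotient_continuous => -[g q].
pose k (y : lawson_pieces Gamma) := point_of (group_elt (reflection_groupM Hh (set_mem (valP g)))) y.2.
have ck : {for (g, q), continuous k}.
  by apply: continuous_comp; [exact: cvg_snd|exact: point_of_continuous].
apply: near_eq_continuous ck.
(* The group is discrete, so the first coordinate is constant near (g, q). *)
have ng : nbhs ((g, q) : lawson_pieces Gamma) [set y | y.1 = g].
  exists ([set g], setT) => /=; last by move=> y [].
  by split; [exact: discrete_set1|exact: filterT].
apply: filterS ng => -[g' q'] /= ->.
by have := translate_point Hh (set_mem (valP g)) q'; rewrite group_elt_val /k => ->.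
Qed.

Lemma translate_involutive h (Hh : G h) x : h * h = 1 ->
  translate Hh (translate Hh x) = x.
Proof.
move=> hh; have [g [q ->]] := point_of_surj x.
rewrite -(group_elt_val g) !translate_point; congr point_of; apply: val_inj => /=.
by rewrite mulrA hh mul1r.
Qed.

End LawsonSpace.

(** * Points of the surface along the edges of the polygon *)

Section Boundary.
Context {R : realType}.
Variables (Gamma : polygon R) (f : 'rV[R]_2 -> 'rV[R]_4).
Hypothesis span : disk_spanning Gamma f.
Local Notation G := (reflection_group Gamma).

Lemma unit_circle_compact : compact (@unit_circle R).
Proof.
apply: bounded_closed_compact.
  exists 1; split; first exact: num_real.
  move=> M M1 p pp; apply: le_trans (ltW M1).
  by rewrite -(@expr_le1 _ 2) // -[leRHS]pp norm_sqr_le_dotv.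
have -> : @unit_circle R = (fun p => dotv p p) @^-1` [set 1] by [].
apply: closed_comp; last exact: closed_eq.
by move=> p _; apply: dotv_continuous; exact: cvg_id.
Qed.

Lemma unit_circle_disk : @unit_circle R `<=` @closed_disk R.
Proof. by move=> p; rewrite /unit_circle /closed_disk /= => ->. Qed.

Lemma boundary_point y : trace Gamma y ->
  exists q : @closed_disk R, unit_circle (val q) /\ f (val q) = y.
Proof.
move=> ty; have [_ _ _ _ fE] := span.
have : (f @` unit_circle) y by rewrite fE.
move=> [p cp <-]; exists (exist _ p (mem_set (unit_circle_disk cp))).
by [].
Qed.

(* Compactness makes f a homeomorphism from the circle onto the polygon. *)
Lemma boundary_point_near g (q : @closed_disk R) (P : set (lawson_space Gamma f)) :
  unit_circle (val q) -> nbhs (point_of f g q) P ->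
  \forall y \near f (val q), trace Gamma y ->
    exists q' : @closed_disk R,
      [/\ unit_circle (val q'), f (val q') = y & P (point_of f g q')].
Proof.
move=> cq nP; have [_ fc _ finj fE] := span.
have : nbhs q (point_of f g @^-1` P) by exact: point_of_continuous nP.
rewrite nbhsE /= => -[_ [[W oW <-] Wq] WP].
pose K := @unit_circle R `&` ~` W.
have Kc : compact K.
  by apply: compact_closedI; [exact: unit_circle_compact|exact: open_closedC].
have KD : K `<=` @closed_disk R by move=> p [/unit_circle_disk].
have fK : compact (f @` K).
  by apply: continuous_compact Kc; exact: continuous_subspaceW KD fc.
have ofK : open (~` (f @` K)).
  by apply: closed_openC; apply: compact_closed fK; exact: norm_hausdorff.
have nK : ~ (f @` K) (f (val q)).
  move=> [p [cp Wp] fp]; apply: Wp.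
  suff -> : p = val q by [].
  by apply: finj => //; exact: mem_set.
have nfK : nbhs (f (val q)) (~` (f @` K)) by exact: open_nbhs_nbhs.
apply: filterS nfK => y yK; rewrite -fE => -[p cp fp].
pose q' : @closed_disk R := exist _ p (mem_set (unit_circle_disk cp)).
exists q'; split=> //; apply: (WP q').
by apply: contrapT => Wp; apply: yK; exists p.
Qed.

Lemma circle_pt_near n (a b : 'rV[R]_n) (P : set 'rV[R]_n) (d : R) :
  nbhs a P -> 0 < d -> exists s, [/\ 0 < s, s <= d, s <= 1 & P (circle_pt a b s)].
Proof.
move=> /nbhs_ballP[e /= e0 eP] d0.
have N0 : 0 < `|a| + `|b| + 1 by rewrite ltr_wpDl // addr_ge0.
pose s := Num.min (Num.min d 1) (e / (2 * (`|a| + `|b| + 1))).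
have s0 : 0 < s by rewrite !lt_min d0 ltr01 divr_gt0 // mulr_gt0.
have sd : s <= d by rewrite /s !ge_min lexx.
have s1 : s <= 1 by rewrite /s !ge_min lexx orbT.
have se : s <= e / (2 * (`|a| + `|b| + 1)) by rewrite /s ge_min lexx orbT.
exists s; split=> //; apply: eP; rewrite -ball_normE /ball_ /= distrC.
have -> : circle_pt a b s - a = (Num.sqrt (1 - s ^+ 2) - 1) *: a + s *: b.
  by rewrite /circle_pt scalerBl scale1r addrAC.
have s01 : 0 <= s <= 1 by rewrite (ltW s0).
have [r0 r2 _] := sqrt_onemsq_bounds s01.
have rs : `|Num.sqrt (1 - s ^+ 2) - 1| <= s.
  by rewrite ler_norml; apply/andP; split; nra.
apply: le_lt_trans (ler_normD _ _) _; rewrite !normrZ (gtr0_norm s0).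
apply: (@le_lt_trans _ _ (s * (`|a| + `|b| + 1))).
  have H : `|Num.sqrt (1 - s ^+ 2) - 1| * `|a| <= s * `|a| by rewrite ler_wpM2r.
  by rewrite !mulrDr mulr1; lra.
rewrite -(ler_pM2r N0) in se; apply: le_lt_trans se _.
by rewrite invfM mulrA divfK ?gt_eqF // ltr_pdivrMr // mulr_natr mulr2n ltrDl.
Qed.

Lemma edge_points g (q : @closed_disk R) b (P : set (lawson_space Gamma f)) (d : R) :
  unit_circle (val q) -> 0 < d ->
  (forall s, 0 < s -> s <= d -> trace Gamma (circle_pt (f (val q)) b s)) ->
  nbhs (point_of f g q) P ->
  exists s (q' : @closed_disk R), [/\ 0 < s <= 1, s <= d, unit_circle (val q'),
    f (val q') = circle_pt (f (val q)) b s & P (point_of f g q')].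
Proof.
move=> cq d0 tr nP.
have [s [s0 sd s1 Ps]] := circle_pt_near b (boundary_point_near cq nP) d0.
have [q' [cq' fq' Pq']] := Ps (tr s s0 sd).
by exists s, q'; split=> //; rewrite s0.
Qed.

End Boundary.

(** * The bipolar surface at a vertex *)

Lemma orthogonal_basis4 {R : realType} (a0 a1 a2 a3 n : 'rV[R]_4) :
  (forall v0 v1 v2 v3 : R, v0 *: a0 + v1 *: a1 + v2 *: a2 + v3 *: a3 = 0 ->
     [/\ v0 = 0, v1 = 0, v2 = 0 & v3 = 0]) ->
  dotv n a0 = 0 -> dotv n a1 = 0 -> dotv n a2 = 0 -> dotv n a3 = 0 -> n = 0.
Proof.
move=> free n0 n1 n2 n3.
pose B : 'M[R]_4 := \matrix_i (nth 0 [:: a0; a1; a2; a3] i : 'rV[R]_4).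
have Bu : row_free B.
  apply: inj_row_free => v.
  rewrite mulmx_sum_row !big_ord_recl big_ord0 !rowK /= addr0 !addrA.
  move=> /free[v0 v1 v2 v3]; apply/rowP => i; rewrite [RHS]mxE.
  case: i => [[|[|[|[|i]]]] Hi] //.
  - by rewrite -[RHS]v0; congr (v 0 _); exact: val_inj.
  - by rewrite -[RHS]v1; congr (v 0 _); exact: val_inj.
  - by rewrite -[RHS]v2; congr (v 0 _); exact: val_inj.
  - by rewrite -[RHS]v3; congr (v 0 _); exact: val_inj.
have Bn : B *m n^T = 0.
  apply/matrixP => i j; rewrite [RHS]mxE (ord1 j).
  have -> : (B *m n^T) i 0 = dotv n (nth 0 [:: a0; a1; a2; a3] i).
    by rewrite dotvC mxE; apply: eq_bigr => k _; rewrite !mxE.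
  by case: i => [[|[|[|[|i]]]] Hi].
apply: trmx_inj; rewrite trmx0.
move: Bu; rewrite row_free_unit => /mulKmx BK.
by rewrite -[LHS](BK _ n^T) Bn mulmx0.
Qed.

Section NormalForm.
Context {R : realType} {M Mbar : surface R}.
Variables (p : Mbar -> M) (F : M -> 'rV[R]_4) (nu : Mbar -> 'rV[R]_4).
Hypotheses (cp : smooth_covering p) (imF : immersion_in_sphere F).
Hypothesis (gnu : gauss_map (fun x => F (p x)) nu).

Let sF : smooth_vector_map F. Proof. by case: imF. Qed.

Let FF y : dotv (F y) (F y) = 1.
Proof. by case: imF => + _ _; apply. Qed.

Let nn x : dotv (nu x) (nu x) = 1.
Proof. by case: gnu => _ + _ _; apply. Qed.

Let nF x : dotv (nu x) (F (p x)) = 0.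
Proof. by case: gnu => _ _ + _; apply. Qed.

Let chart_differentiable c y : charts c -> chart_dom c y ->
  differentiable (F \o chart_inv c) (chart_map c y).
Proof. exact: smooth_vector_map_differentiable. Qed.

Let chart_immersion c y v : charts c -> chart_dom c y ->
  'D_v (F \o chart_inv c) (chart_map c y) = 0 -> v = 0.
Proof. by case: imF => _ _ H cc cy; apply: H => //; exact: chart_codP. Qed.

Lemma normal_conormal x : conormal F (p x) (nu x).
Proof.
have [c cc cpx] := chart_at (p x).
have nX : conormal (F \o chart_inv c) (chart_map c (p x)) (nu x).
  apply: immersion_conormal => [|v|v]; first exact: chart_differentiable.
    exact: chart_immersion.
  exact: gauss_map_base.
apply: conormal_pullback (chart_map_continuous cc cpx) nX _.
by apply: filterS (chart_nbhs cc cpx) => y cy /=; rewrite !chart_mapK.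
Qed.

Lemma conormal_chart c y n : charts c -> chart_dom c y -> conormal F y n ->
  forall v, dotv n ('D_v (F \o chart_inv c) (chart_map c y)) = 0.
Proof.
move=> cc cy ny v; apply: conormal_derive; first exact: chart_differentiable.
apply: (@conormal_pullback _ _ _ _ _ F _ (chart_inv c) _ n).
- exact: chart_inv_continuous cc (chart_codP cy).
- by rewrite chart_mapK.
- by apply: filterS (chart_cod_nbhs cc cy).
Qed.

Lemma chart_tangent_sphere c y v : charts c -> chart_dom c y ->
  dotv (F y) ('D_v (F \o chart_inv c) (chart_map c y)) = 0.
Proof.
move=> cc cy; have := @derive_sphere _ (F \o chart_inv c) (chart_cod c)
  (chart_open cc) (sF cc 2%N) (fun w _ => FF _) _ v (chart_codP cy).
by rewrite /= chart_mapK.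
Qed.

(** Position, normal and two chart tangents form a basis of R^4. Conormals travel along
    homeomorphisms, and this recovers the normal from them up to a factor. *)
Lemma normal_unique x n : conormal F (p x) n -> dotv n (F (p x)) = 0 ->
  n = dotv n (nu x) *: nu x.
Proof.
move=> cn nFx; have [c cc cpx] := chart_at (p x).
set X := F \o chart_inv c; set u := chart_map c (p x).
have dX : differentiable X u by exact: chart_differentiable.
have [t tE] : exists t : 'I_2 -> 'rV[R]_4, forall i, t i = 'D_(delta_mx 0 i) X u.
  by exists (fun i => 'D_(delta_mx 0 i) X u).
have Ft i : dotv (F (p x)) (t i) = 0 by rewrite tE; exact: chart_tangent_sphere.
have nt i : dotv (nu x) (t i) = 0 by rewrite tE; exact: gauss_map_base.
have cnt i : dotv n (t i) = 0 by rewrite tE; exact: conormal_chart.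
have t_free (v2 v3 : R) : v2 *: t 0 + v3 *: t 1 = 0 -> v2 = 0 /\ v3 = 0.
  rewrite !tE => E.
  have : v2 *: delta_mx 0 0 + v3 *: delta_mx 0 1 = 0 :> 'rV[R]_2.
    apply: (@chart_immersion c (p x) _ cc cpx); rewrite -/X -/u -[RHS]E.
    by rewrite deriveE // linearD !linearZ /= -!deriveE.
  move=> /rowP E2; have := E2 0; have := E2 1.
  by rewrite !mxE /= !(mulr1, mulr0, addr0, add0r).
apply/eqP; rewrite -subr_eq0; apply/eqP.
apply: (@orthogonal_basis4 _ (F (p x)) (nu x) (t 0) (t 1)).
- move=> v0 v1 v2 v3 E.
  have v00 : v0 = 0.
    have := congr1 (dotv (F (p x))) E.
    by rewrite !(dotvDr, dotvZr) FF (dotvC _ (nu x)) nF !Ft dotv0r; lra.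
  have v10 : v1 = 0.
    have := congr1 (dotv (nu x)) E.
    by rewrite !(dotvDr, dotvZr) nn nF !nt dotv0r; lra.
  by move: E; rewrite v00 v10 !scale0r !add0r => /t_free[-> ->].
- by rewrite dotvBl dotvZl nFx nF mulr0 subr0.
- by rewrite dotvBl dotvZl nn mulr1 subrr.
- by rewrite dotvBl dotvZl cnt nt mulr0 subr0.
- by rewrite dotvBl dotvZl cnt nt mulr0 subr0.
Qed.

Hypothesis minF : forall c u, charts c -> chart_cod c u ->
  mean_curvature (F \o chart_inv c) u = 0.

Variables (x : Mbar) (b c : 'rV[R]_4).
Local Notation a := (F (p x)).
Local Notation n := (nu x).
Hypothesis frame : orthonormal4 a n b c.
(* The surface contains a geodesic arc leaving x in direction b, along which
   the normal stays orthogonal to b. *)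
Hypothesis edge : forall P : set M, nbhs (p x) P -> exists s y,
  [/\ 0 < s <= 1, P y, F y = circle_pt a b s &
      forall x', p x' = y -> dotv (nu x') b = 0].

Local Notation psit := (bipolar (fun y => F (p y)) nu).

(* In the frame (b, c) the shape operator at x is l times the swap, so the
   bipolar tangent plane is spanned by b^n + l a^c and c^n + l a^b. *)
Lemma bipolar_conormal : exists l : R,
  conormal psit x (wedge b a + l *: wedge c n) /\
  forall k s : R, conormal psit x
    (wedge b (k *: a + s *: n) + l *: wedge c (- s *: a + k *: n)) -> s = 0.
Proof.
have [d cd dpx] := chart_at (p x).
have [G locG] := covering_section x cp.
have [[Gx cpt] cG pG Gp _] := locG.
pose X := F \o chart_inv d; pose N := nu \o G \o chart_inv d.
pose u := chart_map d (p x).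
have Uu : chart_cod d u by exact: chart_codP.
have X2 : class_C 2 (chart_cod d) X by exact: sF.
have dX : differentiable X u by exact: chart_differentiable.
have dN : differentiable N u by exact: (gauss_map_differentiable gnu cd dpx locG).
have iX v : 'D_v X u = 0 -> v = 0 by exact: (@chart_immersion d (p x) v cd dpx).
have Xu : X u = a by rewrite /X /= chart_mapK.
have Nu : N u = n by rewrite /N /= chart_mapK // Gx.
have near_pG : \forall w \near u, p (G (chart_inv d w)) = chart_inv d w.
  exact: (chart_inv_cvg cd dpx pG).
have near_U : \forall w \near u, chart_cod d w by exact: chart_cod_nbhs.
have NN : \forall w \near u, dotv (N w) (N w) = 1.
  by near=> w; exact: nn.
have NX : \forall w \near u, dotv (N w) (X w) = 0.
  by apply: filterS near_pG => w pw; rewrite /N /X /= -[in F _]pw nF.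
have NdX v : \forall w \near u, dotv (N w) ('D_v X w) = 0.
  apply: filterS2 near_pG near_U => w pw Uw.
  have := @gauss_map_base _ _ _ _ _ _ _ cp sF gnu (G (chart_inv d w)) d v cd.
  by rewrite pw chart_invK //; apply; exact: chart_inv_dom.
have frame' : orthonormal4 (X u) (N u) b c by rewrite Xu Nu.
have [q [l shape]] := shape_operator (chart_open cd) Uu X2 iX dN
  (fun w _ => FF _) NX NdX (minF cd Uu) frame'.
have [[aa _ bb cc] [an ab ac [nb nc bc]]] := frame.
(* The function N . b vanishes at the edge points, while its derivative at [u] has coefficient [q]
   in direction [b]. *)
have q0 : q = 0.
  apply: (@edge_differential _ X (fun w => dotv (N w) b) u a b c q l) => //.
  - exact: dotv_differentiable.
  - move=> v; rewrite derive_dotv_cst; last exact: diff_derivable.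
    by rewrite dotvC; have [] := shape v.
  move=> P nP.
  have nP' : nbhs (p x) (chart_map d @^-1` P).
    exact: (chart_map_continuous cd dpx nP).
  have nQ : nbhs (p x) ((chart_map d @^-1` P) `&`
      (chart_dom d `&` [set y | p (G y) = y])).
    by apply: filterI => //; apply: filterI => //; exact: chart_nbhs.
  have [s [y [s01 [Py [dy pGy]] Fy ny]]] := edge nQ.
  exists s, (chart_map d y); split=> //; first by rewrite /X /= chart_mapK.
  by rewrite Nu nb /N /= chart_mapK // ny.
subst q; exists l.
pose Psi w := wedge (X w) (N w).
have dPsi : differentiable Psi u by exact: wedge_differentiable.
(* One computation serves both claims: k = 1, s = 0 gives the form that annihilates the tangent
   plane, and the factor 1 + l^2 > 0 shows what a turned form would require. *)
have dPsiE k s v : dotv (wedge b (k *: a + s *: n) +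
    l *: wedge c (- s *: a + k *: n)) ('D_v Psi u) =
    s * (1 + l ^+ 2) * dotv b ('D_v X u).
  have [] := shape v; rewrite !mul0r add0r subr0 => Nb Nc.
  rewrite dotvDl dotvZl !derive_wedge // Xu Nu Nb Nc.
  have aN := derive_normal_position Uu X2 dN NX NdX v; rewrite Xu in aN.
  have nN := derive_normal_unit dN NN v; rewrite Nu in nN.
  have nX := nbhs_singleton (NdX v); rewrite Nu in nX.
  have aX := chart_tangent_sphere v cd dpx; rewrite -/X -/u in aX.
  rewrite !(dotvDl, dotvZl, dotvDr, dotvZr) (dotvC b a) (dotvC c a) (dotvC b n).
  rewrite (dotvC c n) (dotvC n a) ab ac nb nc an aa nn aN nN nX aX; ring.
(* Pairing with the wedge of D_v X and [n] isolates the squared length of D_v X, so the bipolar map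
   is an immersion for every [l]. *)
have iPsi v : 'D_v Psi u = 0 -> v = 0.
  move=> Pv; apply: iX; apply: dotv_eq0.
  have := derive_wedge dX dN ('D_v X u) n v.
  rewrite -/Psi Pv dotv0r Xu Nu nn (dotvC _ a).
  have nN := derive_normal_unit dN NN v; rewrite Nu in nN.
  have nX := nbhs_singleton (NdX v); rewrite Nu in nX.
  have aX := chart_tangent_sphere v cd dpx; rewrite -/X -/u in aX.
  by rewrite aX nN nX (dotvC n a) an (dotvC _ n) nX => ->; ring.
have PsiP w : conormal Psi u w <-> conormal psit x w.
  split=> H.
    apply: (conormal_pullback (h := chart_map d \o p) _ H).
      exact: continuous_comp cpt (chart_map_continuous cd dpx).
    have near_d : \forall y \near x, chart_dom d (p y).
      exact: (cpt _ (chart_nbhs cd dpx)).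
    apply: filterS2 Gp near_d => y Gy dy.
    by rewrite /Psi /X /N /bipolar /= !chart_mapK // Gy Gx.
  apply: (@conormal_pullback _ _ _ _ _ psit _ (G \o chart_inv d) _ w).
  - have h : G \o chart_inv d @ u --> (G \o chart_inv d) u.
      rewrite [X in _ --> X]/= chart_mapK // Gx.
      exact: section_chart_cvg cd dpx Gx cG.
    exact: h.
  - by rewrite /= chart_mapK // Gx.
  apply: filterS near_pG => y py.
  by rewrite /Psi /X /N /bipolar /= py chart_mapK // Gx.
split.
  apply/PsiP; apply: immersion_conormal => // v.
  have := dPsiE 1 0 v.
  by rewrite scale1r scale0r addr0 oppr0 scale0r add0r scale1r !mul0r.
move=> k s /PsiP H.
have sX v : s * (1 + l ^+ 2) * dotv b ('D_v X u) = 0.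
  by rewrite -(dPsiE k) conormal_derive.
apply/eqP; apply: contraT => s0.
have l0 : s * (1 + l ^+ 2) != 0.
  by rewrite mulf_neq0 // gt_eqF // ltr_pwDl // sqr_ge0.
have bX v : dotv b ('D_v X u) = 0.
  by have /eqP := sX v; rewrite mulf_eq0 (negPf l0) => /eqP.
have X0 v : dotv c ('D_v X u) = 0 -> v = 0.
  move=> cX; apply: iX; apply: (orthonormal4_eq0 frame) => //.
    exact: chart_tangent_sphere.
  by rewrite -Nu; exact: nbhs_singleton (NdX v).
have [t tE] : exists t : 'I_2 -> 'rV[R]_4, forall i, t i = 'D_(delta_mx 0 i) X u.
  by exists (fun i => 'D_(delta_mx 0 i) X u).
(* All tangent vectors are now multiples of [c], so this combination of the coordinate directions is
   killed by the derivative, against the independence of the two partials. *)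
have : dotv c (t 1) *: delta_mx 0 0 - dotv c (t 0) *: delta_mx 0 1 = 0 :> 'rV[R]_2.
  apply: X0.
  have -> : 'D_(dotv c (t 1) *: delta_mx 0 0 - dotv c (t 0) *: delta_mx 0 1) X u =
      dotv c (t 1) *: t 0 - dotv c (t 0) *: t 1.
    by rewrite !tE deriveE // linearB !linearZ /= -!deriveE // scalerN.
  by rewrite dotvBr !dotvZr mulrC subrr.
move=> /rowP E; have := E 1; rewrite !mxE /= mulr0 mulr1 sub0r => /eqP.
rewrite oppr_eq0 => /eqP ct0.
have /rowP e0 : (delta_mx 0 0 : 'rV[R]_2) = 0 by apply: X0; rewrite -tE.
by have := e0 0; rewrite !mxE /= => /eqP; rewrite oner_eq0.
Unshelve. all: by end_near. Qed.

End NormalForm.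

Lemma neg_sqr_eq1 {R : realType} (t : R) : t < 0 -> t ^+ 2 = 1 -> t = -1.
Proof.
move=> t0 /eqP; rewrite sqrf_eq1 => /orP[] /eqP // t1.
by move: t0; rewrite t1 ltr10.
Qed.

Section Isometries.
Context {R : realType}.
Implicit Types (h : 'M[R]_4) (u v w z : 'rV[R]_4).

Lemma act_add h u v : act h (u + v) = act h u + act h v.
Proof. exact: mulmxDl. Qed.

Lemma act_sub h u v : act h (u - v) = act h u - act h v.
Proof. exact: mulmxBl. Qed.

Lemma act_scale h (k : R) u : act h (k *: u) = k *: act h u.
Proof. by rewrite /act scalemxAl. Qed.

Lemma act_continuous h : continuous (act h).
Proof.
move=> v; apply: differentiable_continuous; apply: differentiable_rV => i.
rewrite (_ : (fun y => _) = (fun y => dotv y (row i h))); last first.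
  apply/funext => y; rewrite /act mxE.
  by apply: eq_bigr => j _; rewrite !mxE.
exact: dotv_differentiable.
Qed.

Lemma act_isometry h u v : special_orthogonal h ->
  dotv (act h u) (act h v) = dotv u v.
Proof.
move=> [hh _]; have hh' := mulmx1C hh.
by rewrite !dotv_mx /act trmx_mul trmxK mulmxA -(mulmxA u) hh' mulmx1.
Qed.

Lemma wedge_isometry h u v w z : special_orthogonal h ->
  dotv (wedge (act h u) (act h v)) (wedge (act h w) (act h z)) =
  dotv (wedge u v) (wedge w z).
Proof. by move=> hh; rewrite !dotv_wedge !act_isometry. Qed.

Lemma wedgeNl u v : wedge (- u) v = - wedge u v.
Proof.
apply/rowP => -[[|[|[|[|[|[|i]]]]]] Hi] //; rewrite !mxE /= /minor !mxE; ring.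
Qed.

Lemma wedgeNr u v : wedge u (- v) = - wedge u v.
Proof.
apply/rowP => -[[|[|[|[|[|[|i]]]]]] Hi] //; rewrite !mxE /= /minor !mxE; ring.
Qed.

Lemma wedge_rotation u v (k s : R) : k ^+ 2 + s ^+ 2 = 1 ->
  wedge (k *: u + s *: v) (- s *: u + k *: v) = wedge u v.
Proof.
move=> ks; have E i j : minor (k *: u + s *: v) (- s *: u + k *: v) i j =
    (k ^+ 2 + s ^+ 2) * minor u v i j.
  by rewrite /minor !mxE; ring.
by apply/rowP => -[[|[|[|[|[|[|i]]]]]] Hi] //; rewrite !mxE /= E ks mul1r.
Qed.

End Isometries.

Section Embedding.
Context {R : realType} {n : nat} {M : surface R}.

(* A double point of the map is a single point of an embedded fundamental
   domain, so both sheets have the same tangent plane there. *)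
Lemma embedded_conormal (F : M -> 'rV[R]_n.+1) x x' w :
  embedded_surface F -> F x = F x' -> conormal F x' w -> conormal F x w.
Proof.
move=> [Sigma [q [phi [[cq _ FE _] [_ injphi _]]]]] Fxx' cw.
have qE : q x = q x' by apply: injphi; move: Fxx'; rewrite FE.
have [G [[Gx' _] cG qG _ _]] := covering_section x' cq.
have [_ [[_ cqx] _ _ _ _]] := covering_section x cq.
have Tx : (G \o q) x = x' by rewrite /= qE.
have cGx : {for q x, continuous G} by rewrite qE; exact: cG.
have cT := continuous_comp cqx cGx.
apply: (conormal_pullback (F := F) cT (a := w)); first by rewrite Tx.
have near_q : \forall z \near x, q (G (q z)) = q z.
  by rewrite -qE in qG; exact: cqx _ qG.
by apply: filterS near_q => z qz; rewrite Tx -Fxx' FE /= qz.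
Qed.

End Embedding.

(** * Normals of a piece and of its mirror image *)

Section LawsonGaussMap.
Context {R : realType}.
Variables (Gamma : polygon R) (f : 'rV[R]_2 -> 'rV[R]_4).
Hypothesis span : disk_spanning Gamma f.
Variable A : smooth_structure R (lawson_space Gamma f).
Local Notation M := (Surface A).
Let F : M -> 'rV[R]_4 := lawson_map (Gamma := Gamma) (f := f).
Hypothesis imF : immersion_in_sphere F.
Variables (Sbar : surface R) (p : Sbar -> M).
Hypotheses (cp : smooth_covering p)
  (fib : forall y, exists x1 x2, p @^-1` [set y] = [set x1; x2]).
Variable nu : Sbar -> 'rV[R]_4.
Hypothesis gnu : gauss_map (fun x => F (p x)) nu.

Local Notation G := (reflection_group Gamma).
Let alpha (q : @closed_disk R) : M := point_of f (group_elt (@reflection_group1 _ Gamma)) q.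

Let F_alpha q : F (alpha q) = f (val q).
Proof. by rewrite /F lawson_map_point act1. Qed.

Let FF y : dotv (F y) (F y) = 1.
Proof. by case: imF => + _ _; apply. Qed.

Let nn x : dotv (nu x) (nu x) = 1.
Proof. by case: gnu => _ + _ _; apply. Qed.

Let nF x : dotv (nu x) (F (p x)) = 0.
Proof. by case: gnu => _ _ + _; apply. Qed.

(** An edge point at parameter [s] is displaced by s t along the normal, whereas conormality allows
    only o(s); the constant t^2 / 4 plays the same part as in [edge_differential]. *)
Lemma normal_edge x q w (d : R) : p x = alpha q -> unit_circle (val q) ->
  dotv w w = 1 -> dotv (f (val q)) w = 0 -> 0 < d ->
  (forall s, 0 < s -> s <= d -> trace Gamma (circle_pt (f (val q)) w s)) ->
  dotv (nu x) w = 0.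
Proof.
move=> px cq ww fw d0 tr; apply/eqP; apply: contraT => t0.
set t := dotv (nu x) w in t0.
have t20 : 0 < t ^+ 2 by rewrite exprn_even_gt0.
have e0 : 0 < t ^+ 2 / 4 by rewrite divr_gt0.
have nP := normal_conormal cp imF gnu x e0; rewrite px in nP.
have [s [q' [s01 sd _ fq' Pq']]] := edge_points span cq d0 tr nP.
have [s0 s1] := andP s01.
have aa : dotv (f (val q)) (f (val q)) = 1 by rewrite -F_alpha.
have s01' : 0 <= s <= 1 by rewrite (ltW s0).
have := circle_pt_increment aa ww fw s01'.
have na : dotv (nu x) (f (val q)) = 0 by rewrite -F_alpha -px.
have E : dotv (nu x) (circle_pt (f (val q)) w s - f (val q)) = s * t.
  by rewrite /circle_pt dotvBr dotvDr !dotvZr na mulr0 add0r subr0.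
have := Pq'; rewrite /= -/(alpha q') !F_alpha fq' E exprMn.
move=> H1 H2; have s2 : 0 < s ^+ 2 by rewrite exprn_gt0.
have : s ^+ 2 * t ^+ 2 <= t ^+ 2 / 4 * (2 * s ^+ 2).
  by apply: le_trans H1 _; rewrite ler_pM2l.
have : 0 < s ^+ 2 * t ^+ 2 by rewrite mulr_gt0.
lra.
Qed.

Variables (r : 'M[R]_4) (Hr : G r).
Hypotheses (so : special_orthogonal r) (rr : r * r = 1).
Local Notation tau := (translate (f := f) Hr).

Let F_tau y : F (tau y) = act r (F y).
Proof. exact: lawson_map_translate. Qed.

Let tauK y : tau (tau y) = y.
Proof. exact: translate_involutive. Qed.

Let actK u : act r (act r u) = u.
Proof. by rewrite -actM rr act1. Qed.

(** The transported normal is a conormal at the image point, hence a multiple of the normal there by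
    [normal_unique]; unit length leaves only a sign. *)
Lemma normal_translate x x' : p x' = tau (p x) ->
  nu x' = dotv (nu x') (act r (nu x)) *: act r (nu x) /\
  dotv (nu x') (act r (nu x)) ^+ 2 = 1.
Proof.
move=> px; have ptau : tau (p x') = p x by rewrite px tauK.
have cn : conormal F (p x') (act r (nu x)).
  apply: (@conormal_pullback _ _ _ _ _ F F tau _ (nu x)).
  - exact: translate_continuous.
  - by rewrite ptau; exact: normal_conormal.
  - apply: filterE => z; rewrite !F_tau.
    by rewrite -act_sub -{1}(actK (F z - _)) !act_isometry.
have nr : dotv (act r (nu x)) (F (p x')) = 0.
  by rewrite px F_tau act_isometry.
have E := normal_unique cp imF gnu cn nr.
set k := dotv _ _ in E *; rewrite dotvC -/k.
have k1 : k ^+ 2 = 1.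
  have := nn x; rewrite -(act_isometry _ _ so) E dotvZl dotvZr nn mulr1.
  by rewrite -expr2.
by split=> //; rewrite E scalerA -expr2 k1 scale1r.
Qed.

Let phi z z' := dotv (nu z') (act r (nu z)).

Let nu_continuous z : {for z, continuous nu}.
Proof. by apply: smooth_vector_map_continuous; case: gnu. Qed.

Let phi_open x x' (s : R) : 0 < s * phi x x' -> exists W W',
  [/\ nbhs x W, nbhs x' W' & forall z z', W z -> W' z' -> 0 < s * phi z z'].
Proof.
move=> sphi.
have c1 : {for (x, x'), continuous (fun y : Sbar * Sbar => nu y.2)}.
  by apply: continuous_comp; [exact: cvg_snd|exact: nu_continuous].
have c2 : {for (x, x'), continuous (fun y : Sbar * Sbar => act r (nu y.1))}.
  apply: (@continuous_comp _ _ _ (fun y : Sbar * Sbar => nu y.1)).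
    by apply: continuous_comp; [exact: cvg_fst|exact: nu_continuous].
  exact: act_continuous.
have c : {for (x, x'), continuous (fun y : Sbar * Sbar => s * phi y.1 y.2)}.
  by apply: continuousM; [exact: cst_continuous|exact: dotv_continuous].
have pos : nbhs (s * phi x x') [set y : R | 0 < y].
  by apply: open_nbhs_nbhs; split=> //; exact: open_gt.
have [[W W'] /= [nW nW'] WP] := c _ pos.
by exists W, W'; split=> // z z' Wz Wz'; exact: (WP (z, z')).
Qed.

Local Notation beta := (point_of f (group_elt Hr)).

Let beta_tau q : beta q = tau (alpha q).
Proof.
rewrite /alpha translate_point; congr point_of; apply: val_inj => /=.
by rewrite mulr1.
Qed.

(** On a double cover both signs may occur over the same [q], so the sign is no function of [q].
    What is locally constant is the existence of a pair of lifts with sign [s]. *)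
Let linked (s : R) q := exists x x' : Sbar,
  [/\ p x = alpha q, p x' = beta q & 0 < s * phi x x'].

Let linked_near s q : linked s q -> \forall q' \near q, linked s q'.
Proof.
move=> [x [x' [px px' H]]]; have [W [W' [nW nW' WP]]] := phi_open H.
have := covering_lift_near cp nW; rewrite px => n1.
have := covering_lift_near cp nW'; rewrite px' => n2.
have n1' : \forall q' \near q, exists2 z, p z = alpha q' & W z.
  exact: (point_of_continuous n1).
have n2' : \forall q' \near q, exists2 z, p z = beta q' & W' z.
  exact: (point_of_continuous n2).
apply: filterS2 n1' n2' => q' [z pz Wz] [z' pz' Wz'].
by exists z, z'; split=> //; exact: WP.
Qed.

Let not_linked_near s q : s ^+ 2 = 1 -> ~ linked s q ->
  \forall q' \near q, ~ linked s q'.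
Proof.
move=> s2 nl; have [x1 [x2 fx]] := fib (alpha q).
have [y1 [y2 fy]] := fib (beta q).
have px1 : p x1 = alpha q by have : (p @^-1` [set alpha q]) x1 by rewrite fx; left.
have px2 : p x2 = alpha q by have : (p @^-1` [set alpha q]) x2 by rewrite fx; right.
have py1 : p y1 = beta q by have : (p @^-1` [set beta q]) y1 by rewrite fy; left.
have py2 : p y2 = beta q by have : (p @^-1` [set beta q]) y2 by rewrite fy; right.
(* Since phi x y squares to 1, a pair without sign [s] has the opposite strict sign, which is an
   open condition. *)
have pos x y : p x = alpha q -> p y = beta q -> 0 < - s * phi x y.
  move=> px py; rewrite ltNge; apply/negP => H; apply: nl; exists x, y.
  split=> //; rewrite lt_neqAle; apply/andP; split; last by lra.
  have [_ k2] : nu y = phi x y *: act r (nu x) /\ phi x y ^+ 2 = 1.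
    by apply: normal_translate; rewrite py px beta_tau.
  apply/eqP => E; have : s ^+ 2 * phi x y ^+ 2 = 0 by rewrite -exprMn -E expr0n.
  by rewrite s2 k2 mulr1 => /eqP; rewrite oner_eq0.
(* Four pairs of lifts exhaust the two fibres; suitable intersections of their neighbourhoods catch
   every pair of lifts nearby. *)
have [A1 [B1 [nA1 nB1 P1]]] := phi_open (pos _ _ px1 py1).
have [A2 [B2 [nA2 nB2 P2]]] := phi_open (pos _ _ px1 py2).
have [A3 [B3 [nA3 nB3 P3]]] := phi_open (pos _ _ px2 py1).
have [A4 [B4 [nA4 nB4 P4]]] := phi_open (pos _ _ px2 py2).
have n1 : \forall y \near alpha q, forall x, p x = y ->
    ((A1 `&` A2) `|` (A3 `&` A4)) x.
  apply: covering_fiber_near cp fx _ _.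
    by apply: filterS (filterI nA1 nA2) => z; left.
  by apply: filterS (filterI nA3 nA4) => z; right.
have n2 : \forall y \near beta q, forall x, p x = y ->
    ((B1 `&` B3) `|` (B2 `&` B4)) x.
  apply: covering_fiber_near cp fy _ _.
    by apply: filterS (filterI nB1 nB3) => z; left.
  by apply: filterS (filterI nB2 nB4) => z; right.
have n1' : \forall q' \near q, forall x, p x = alpha q' ->
    ((A1 `&` A2) `|` (A3 `&` A4)) x.
  exact: (point_of_continuous n1).
have n2' : \forall q' \near q, forall x, p x = beta q' ->
    ((B1 `&` B3) `|` (B2 `&` B4)) x.
  exact: (point_of_continuous n2).
apply: filterS2 n1' n2' => q' H1 H2 [x [y [px py]]].
rewrite ltNge => /negP; apply; rewrite -oppr_ge0 -mulNr.
case: (H1 x px) => -[a1 a2]; case: (H2 y py) => -[b1 b2]; apply: ltW.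
- exact: P1.
- exact: P2.
- exact: P3.
- exact: P4.
Qed.

(* The sign comparing the normals of a piece and of its image under r is locally
   constant, and it is -1 where the two pieces meet. *)
Lemma opposite_normals q0 q1 x1 : p x1 = alpha q1 -> alpha q1 = beta q1 ->
  act r (nu x1) = - nu x1 ->
  exists x x', [/\ p x = alpha q0, p x' = tau (p x) & nu x' = - act r (nu x)].
Proof.
move=> px1 ab rnu.
(* Both pieces share the point below [x1], so [x1] serves as a lift for each of them. *)
have l1 : linked (-1) q1.
  by exists x1, x1; split; rewrite -?ab // /phi rnu dotvNr nn mulrNN mulr1.
have seg_disk (t : R) (q q' : @closed_disk R) : 0 <= t <= 1 ->
    closed_disk ((1 - t) *: val q + t *: val q').
  move=> /andP[t0 t1].
  have H : dotv (val q) (val q) <= 1 := set_mem (valP q).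
  have H' : dotv (val q') (val q') <= 1 := set_mem (valP q').
  have := dotv_ge0 (val q - val q').
  rewrite /closed_disk /= !(dotvBl, dotvBr, dotvDl, dotvDr, dotvZl, dotvZr).
  rewrite (dotvC (val q') (val q)); set C := dotv (val q) (val q') => C1.
  have t1' : 0 <= 1 - t by rewrite subr_ge0.
  have := mulr_ge0 (mulr_ge0 t0 t1') C1.
  have := mulr_ge0 t1' (_ : 0 <= 1 - dotv (val q) (val q)).
  have := mulr_ge0 t0 (_ : 0 <= 1 - dotv (val q') (val q')).
  rewrite !subr_ge0 => /(_ H') ? /(_ H) ?; lra.
(* Clamping extends the segment from [q1] to [q0] to a path on all of R, whose connectedness is then
   used. *)
have clamp (t : R) : 0 <= Num.max 0 (Num.min t 1) <= 1.
  by rewrite le_max lexx /= ge_max ler01 ge_min lexx orbT.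
pose cl (t : R) := Num.max 0 (Num.min t 1).
pose gam (t : R) : @closed_disk R :=
  exist _ ((1 - cl t) *: val q1 + cl t *: val q0)
    (mem_set (seg_disk _ q1 q0 (clamp t))).
have gam_continuous : continuous gam.
  apply/continuous_comp_initial => t.
  have cc : {for t, continuous cl}.
    apply: continuous_max; first exact: cst_continuous.
    by apply: continuous_min; [exact: cvg_id|exact: cst_continuous].
  apply: cvgD; apply: cvgZr_tmp; last exact: cc.
  by apply: cvgB; [exact: cvg_cst|exact: cc].
have g0 : gam 0 = q1.
  apply: val_inj; rewrite /= /cl (min_idPl ler01) maxxx.
  by rewrite subr0 scale1r scale0r addr0.
have g1 : gam 1 = q0.
  apply: val_inj; rewrite /= /cl minxx (max_idPr ler01).
  by rewrite subrr scale0r scale1r add0r.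
pose B := [set t | linked (-1) (gam t)].
have Bo : open B.
  rewrite openE => t Bt; exact: gam_continuous (linked_near Bt).
have Bc : closed B.
  rewrite -openC openE => t Bt; apply: gam_continuous (not_linked_near _ Bt).
  by rewrite sqrrN expr1n.
have BT : B = setT.
  have := (@connected_intervalP R setT).2 (fun _ _ _ _ _ _ => I).
  apply; first by exists 0; rewrite /B /= g0.
  - by exists B => //; rewrite setTI.
  - by exists B => //; rewrite setTI.
have : B 1 by rewrite BT.
rewrite /B /= g1 => -[x [x' [px px' H]]]; exists x, x'.
have px2 : p x' = tau (p x) by rewrite px px' beta_tau.
split=> //; have [E k2] := normal_translate px2; rewrite E.
rewrite (neg_sqr_eq1 _ k2) ?scaleN1r //.
by move: H; rewrite mulN1r oppr_gt0.
Qed.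

End LawsonGaussMap.

(** * The contradiction at a vertex *)

Section Corner.
Context {R : realType}.
Variables (Gamma : polygon R) (f : 'rV[R]_2 -> 'rV[R]_4).
Hypothesis span : disk_spanning Gamma f.
Variable A : smooth_structure R (lawson_space Gamma f).
Local Notation M := (Surface A).
Let F : M -> 'rV[R]_4 := lawson_map (Gamma := Gamma) (f := f).
Hypothesis minF : minimal_immersion F.
Variables (Sbar : surface R) (p : Sbar -> M).
Hypothesis orp : orientation_cover p.
Variable nu : Sbar -> 'rV[R]_4.
Hypothesis gnu : gauss_map (fun x => F (p x)) nu.

Variables (a b c d : 'rV[R]_4) (e : edge R) (r : 'M[R]_4).
Hypotheses (aa : dotv a a = 1) (bb : dotv b b = 1) (cc : dotv c c = 1)
  (dd : dotv d d = 1) (ab : dotv a b = 0) (ac : dotv a c = 0)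
  (db : dotv d b = 0) (dc : dotv d c = 0).
Hypotheses (bc : dotv b c ^+ 2 != 1) (ad0 : dotv a d != 0)
  (ad1 : dotv a d ^+ 2 != 1).
Hypothesis arc_ab : forall s t : R, 0 <= s -> 0 <= t -> s ^+ 2 + t ^+ 2 = 1 ->
  trace Gamma (s *: a + t *: b).
Hypothesis arc_ac : forall s t : R, 0 <= s -> 0 <= t -> s ^+ 2 + t ^+ 2 = 1 ->
  trace Gamma (s *: a + t *: c).
Hypothesis Ge : Gamma e.
Hypothesis arc_bd : forall s t : R, 0 <= s -> 0 <= t -> s ^+ 2 + t ^+ 2 = 1 ->
  edge_arc e (s *: b + t *: d).
Hypothesis er : is_reflection e r.
Hypotheses (rb : act r b = b) (rd : act r d = d)
  (rw : forall w, dotv w b = 0 -> dotv w d = 0 -> act r w = - w).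

Let imF : immersion_in_sphere F. Proof. by case: minF. Qed.
Let cp : smooth_covering p. Proof. by case: (orientation_coverP orp). Qed.
Let fib : forall y, exists x1 x2, p @^-1` [set y] = [set x1; x2].
Proof. by case: (orientation_coverP orp). Qed.
Let so : special_orthogonal r. Proof. by case: er. Qed.
Let Hr : reflection_group Gamma r. Proof. exact: group_reflection Ge er. Qed.
Local Notation tau := (translate (f := f) Hr).

Let nn x : dotv (nu x) (nu x) = 1.
Proof. by case: gnu => _ + _ _; apply. Qed.

Let nF x : dotv (nu x) (F (p x)) = 0.
Proof. by case: gnu => _ _ + _; apply. Qed.

Let alpha (q : @closed_disk R) : M := point_of f (group_elt (@reflection_group1 _ Gamma)) q.

Let F_alpha q : F (alpha q) = f (val q).
Proof. by rewrite /F lawson_map_point act1. Qed.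

Lemma reflection_decomposition (u : 'rV[R]_4) :
  act r u = 2 *: (dotv u b *: b + dotv u d *: d) - u.
Proof.
have H : act r (u - (dotv u b *: b + dotv u d *: d)) =
    - (u - (dotv u b *: b + dotv u d *: d)).
  apply: rw; rewrite dotvBl dotvDl !dotvZl.
    by rewrite bb db mulr0 addr0 mulr1 subrr.
  by rewrite dd (dotvC b) db mulr0 add0r mulr1 subrr.
move: H; rewrite act_sub act_add !act_scale rb rd.
move: (act r u) => v /rowP H.
by apply/rowP => i; have := H i; rewrite !mxE; lra.
Qed.

Let rr : r * r = 1.
Proof.
have rK u : act (r * r) u = u.
  rewrite actM (reflection_decomposition u) act_sub act_scale act_add !act_scale.
  by rewrite rb rd (reflection_decomposition u) opprB addrC subrK.
apply/trmx_inj/row_matrixP => i; rewrite trmx1 -[RHS](rK (row i 1%:M)).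
by rewrite /act rowE row1 -rowE.
Qed.

Let circle_trace u v (s : R) : 0 < s -> s <= 1 / 2 ->
  (forall s t : R, 0 <= s -> 0 <= t -> s ^+ 2 + t ^+ 2 = 1 ->
     trace Gamma (s *: u + t *: v)) -> trace Gamma (circle_pt u v s).
Proof.
move=> s0 s1; apply; [exact: sqrtr_ge0|exact: ltW|].
have s01 : 0 <= s <= 1 by apply/andP; split; lra.
by have [_ -> _] := sqrt_onemsq_bounds s01; rewrite subrK.
Qed.

Let half0 : 0 < 1 / 2 :> R. Proof. by lra. Qed.

(* The bipolar points over the vertex a and over its mirror image r a coincide,
   but by the normal form their tangent planes differ. *)
Theorem corner_not_embedded :
  ~ embedded_surface (bipolar (fun x => F (p x)) nu).
Proof.
move=> emb.
have ta : trace Gamma a.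
  have := arc_ab ler01 (lexx 0) (ltac:(by rewrite expr1n expr0n addr0)).
  by rewrite scale1r scale0r addr0.
have eb : edge_arc e b.
  have := arc_bd ler01 (lexx 0) (ltac:(by rewrite expr1n expr0n addr0)).
  by rewrite scale1r scale0r addr0.
have tb : trace Gamma b by exists e.
have trace_bd s t : 0 <= s -> 0 <= t -> s ^+ 2 + t ^+ 2 = 1 ->
    trace Gamma (s *: b + t *: d) by move=> s0 t0 st; exists e => //; exact: arc_bd.
have [qa [cqa fqa]] := boundary_point span ta.
have [qb [cqb fqb]] := boundary_point span tb.
have normal_a x : p x = alpha qa -> dotv (nu x) a = 0 /\
    dotv (nu x) b = 0 /\ dotv (nu x) c = 0.
  move=> px; split; first by rewrite -fqa -F_alpha -px.
  split; apply: (normal_edge span imF cp gnu px cqa _ _ half0) => //;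
    rewrite ?fqa // => s s0 s1; exact: circle_trace.
(* At [b] the normal is orthogonal to [b] and [d], hence reversed by [r]: the starting point for
   [opposite_normals]. *)
have [xb pxb] : exists xb, p xb = alpha qb by case: cp => + _; apply.
have nb_b : dotv (nu xb) b = 0 by rewrite -fqb -F_alpha -pxb.
have nb_d : dotv (nu xb) d = 0.
  apply: (normal_edge span imF cp gnu pxb cqb _ _ half0) => //.
    by rewrite fqb dotvC.
  by move=> s s0 s1; rewrite fqb; exact: circle_trace.
have ebq : edge_arc e (f (val qb)) by rewrite fqb.
have [x [x' [px px' nux']]] := opposite_normals imF cp fib gnu so rr qa pxb
  (point_of_reflection Hr Ge er ebq) (rw nb_b nb_d).
have [na [nb nc]] := normal_a x px.
have Fx : F (p x) = a by rewrite px F_alpha.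
(* Gram-Schmidt: [m] is the sine of the angle between [b] and [c], nonzero by the hypothesis on
   their product. *)
pose m := Num.sqrt (1 - dotv b c ^+ 2).
have bc1 : dotv b c ^+ 2 < 1.
  rewrite lt_neqAle bc /=.
  have := dotv_ge0 (c - dotv b c *: b).
  by rewrite !(dotvBl, dotvBr, dotvZl, dotvZr) (dotvC c b) bb cc; lra.
have m0 : m != 0 by rewrite gt_eqF // sqrtr_gt0 subr_gt0.
have m2 : m ^+ 2 = 1 - dotv b c ^+ 2 by rewrite sqr_sqrtr // subr_ge0 ltW.
pose c' := m^-1 *: (c - dotv b c *: b).
have cc' : dotv c' c' = 1.
  rewrite /c' dotvZl dotvZr !(dotvBl, dotvBr, dotvZl, dotvZr) (dotvC c b) bb cc.
  apply: (mulIf (_ : m ^+ 2 != 0)); first by rewrite expf_neq0.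
  by rewrite mul1r {2}m2; field.
have ac' : dotv a c' = 0 by rewrite /c' dotvZr dotvBr dotvZr ac ab; ring.
have bc' : dotv b c' = 0 by rewrite /c' dotvZr dotvBr dotvZr bb; ring.
have dc' : dotv d c' = 0 by rewrite /c' dotvZr dotvBr dotvZr db dc; ring.
have nc' : dotv (nu x) c' = 0 by rewrite /c' dotvZr dotvBr dotvZr nb nc; ring.
have an : dotv a (nu x) = 0 by rewrite dotvC.
have frame : orthonormal4 a (nu x) b c'.
  by do !split.
have rc' : act r c' = - c' by apply: rw; rewrite dotvC.
(* In the plane of a and n, r is the reflection in the line of d, so
   (r a, - r n) is the frame (a, n) turned by twice the angle from a to d. *)
pose y := dotv a d; pose z := dotv (nu x) d.
pose k := 2 * y ^+ 2 - 1; pose s := 2 * y * z.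
have yz : y ^+ 2 + z ^+ 2 = 1.
  have := parseval4 d d frame.
  by rewrite dd (dotvC b) db (dotvC c') dc' -/y -/z !expr2 => ->; ring.
have ks : k ^+ 2 + s ^+ 2 = 1.
  have zE : z ^+ 2 = 1 - y ^+ 2 by lra.
  have -> : k ^+ 2 + s ^+ 2 = (2 * y ^+ 2 - 1) ^+ 2 + 4 * y ^+ 2 * z ^+ 2.
    by rewrite /k /s; ring.
  by rewrite zE; ring.
have dE : d = y *: a + z *: nu x.
  apply/eqP; rewrite -subr_eq0; apply/eqP; apply: (orthonormal4_eq0 frame);
    rewrite dotvBr dotvDr !dotvZr.
  - by rewrite aa an -/y; ring.
  - by rewrite na nn -/z; ring.
  - by rewrite (dotvC b) db (dotvC b a) ab (dotvC b) nb; ring.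
  - by rewrite (dotvC c') dc' (dotvC c') ac' (dotvC c') nc'; ring.
have ra : act r a = k *: a + s *: nu x.
  rewrite reflection_decomposition ab -/y {1}dE.
  apply/rowP => i; rewrite !mxE /k /s; ring.
have rn : - act r (nu x) = - s *: a + k *: nu x.
  rewrite reflection_decomposition nb -/z {1}dE.
  apply/rowP => i; rewrite !mxE /k /s.
  have -> : 2 * y ^+ 2 - 1 = 1 - 2 * z ^+ 2 by lra.
  ring.
pose psit := bipolar (fun x => F (p x)) nu.
have Fx' : F (p x') = act r a by rewrite px' /F lawson_map_translate -Fx.
have double : psit x = psit x'.
  by rewrite /psit /bipolar Fx' nux' Fx ra rn wedge_rotation.
have geodesic P : nbhs (p x) P -> exists s y, [/\ 0 < s <= 1, P y,
    F y = circle_pt a b s & forall x', p x' = y -> dotv (nu x') b = 0].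
  rewrite px => nP.
  have tr t : 0 < t -> t <= 1 / 2 -> trace Gamma (circle_pt (f (val qa)) b t).
    by move=> t0 t1; rewrite fqa; exact: circle_trace.
  have [t [q' [t01 t12 cq' fq' Pq']]] := edge_points span cqa half0 tr nP.
  exists t, (alpha q'); split=> //; first by rewrite F_alpha fq' fqa.
  move=> x2 px2; have [t0 _] := andP t01.
  have t01' : 0 <= t <= 1 by apply/andP; split; lra.
  (* [g] and [t] are the cosine and sine of the angle from [a] to the edge point. The edge continues
     to [b] through a further angle with sine [g], which is the bound given to [normal_edge]. *)
  pose g := Num.sqrt (1 - t ^+ 2).
  have g0 : 0 < g by rewrite sqrtr_gt0; nra.
  have g2 : g ^+ 2 = 1 - t ^+ 2 by have [_ ? _] := sqrt_onemsq_bounds t01'.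
  have yE : f (val q') = g *: a + t *: b by rewrite fq' fqa.
  have n1 : dotv (nu x2) (- t *: a + g *: b) = 0.
    apply: (normal_edge span imF cp gnu px2 cq' _ _ g0).
    - rewrite !(dotvDl, dotvDr, dotvZl, dotvZr) aa bb (dotvC b a) ab.
      by rewrite !mulr1 !mulr0 addr0 add0r mulrNN -!expr2 g2 addrC subrK.
    - rewrite yE !(dotvDl, dotvDr, dotvZl, dotvZr) aa bb (dotvC b a) ab; ring.
    move=> v v0 vg; have v01 : 0 <= v <= 1 by apply/andP; split; nra.
    have [h0 h2 _] := sqrt_onemsq_bounds v01.
    rewrite yE /circle_pt; set h := Num.sqrt _ in h0 h2 *.
    (* Angle addition; the first coefficient is nonnegative because v <= g and t <= h, that is, the
       angles add up to at most a right angle. *)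
    have -> : h *: (g *: a + t *: b) + v *: (- t *: a + g *: b) =
        (h * g - v * t) *: a + (h * t + v * g) *: b.
      by apply/rowP => i; rewrite !mxE; ring.
    have th : t <= h.
      by rewrite -(@ler_pXn2r _ 2) ?nnegrE ?(ltW t0) // h2; nra.
    apply: arc_ab.
    - by have := ler_pM (ltW v0) (ltW t0) vg th; lra.
    - by rewrite addr_ge0 // mulr_ge0 // ltW.
    have -> : (h * g - v * t) ^+ 2 + (h * t + v * g) ^+ 2 =
      (h ^+ 2 + v ^+ 2) * (g ^+ 2 + t ^+ 2) by ring.
    by rewrite h2 g2 !subrK mulr1.
  have n2 : dotv (nu x2) (f (val q')) = 0 by rewrite -F_alpha -px2.
  have -> : dotv (nu x2) b =
      t * dotv (nu x2) (f (val q')) + g * dotv (nu x2) (- t *: a + g *: b).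
    rewrite yE !(dotvDr, dotvZr).
    have -> : t * (g * dotv (nu x2) a + t * dotv (nu x2) b) +
        g * (- t * dotv (nu x2) a + g * dotv (nu x2) b) =
        (t ^+ 2 + g ^+ 2) * dotv (nu x2) b by ring.
    by rewrite g2 addrC subrK mul1r.
  by rewrite n1 n2 !mulr0 addr0.
have frame' : orthonormal4 (F (p x)) (nu x) b c' by rewrite Fx.
have := @bipolar_conormal _ _ _ _ _ _ cp imF gnu (proj2 minF) x b c' frame'.
rewrite Fx => /(_ geodesic)[l [om H]].
(* As r b = b and r c' = - c', the reflection carries the conormal form at [x] to the turned form at
   [x']. Embeddedness moves the latter to [x], where the normal form forces s = 0. *)
have s0 : s = 0.
  apply: (H k); rewrite -ra -rn.
  apply: (embedded_conormal emb double).
  (* The symmetry acts on the surface and not on its cover, so a local lift taking [x'] to [x] is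
     built from a section of [p]. *)
  have [T [Tx' cT pT]] : exists T : Sbar -> Sbar,
      [/\ T x' = x, {for x', continuous T} &
          \forall z \near x', p z = tau (p (T z))].
    have [G [[Gx _] cG pG _ _]] := covering_section x cp.
    have [_ [[_ cpx'] _ _ _ _]] := covering_section x' cp.
    have tpx' : tau (p x') = p x by rewrite px' translate_involutive.
    have c1 : tau \o p @ x' --> p x.
      rewrite -[X in _ --> X]tpx'.
      have ct : {for p x', continuous (tau : M -> M)} by exact: translate_continuous.
      exact: (continuous_comp cpx' ct).
    exists (G \o (tau \o p)); split; first by rewrite /= tpx' Gx.
      have c2 : G \o (tau \o p) @ x' --> (G \o (tau \o p)) x'.
        rewrite [X in _ --> X]/= tpx'; exact: cvg_comp c1 cG.
      exact: c2.
    have n1 : \forall z \near x', p (G (tau (p z))) = tau (p z) by exact: c1 _ pG.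
    by apply: filterS n1 => x2 /= ->; rewrite translate_involutive.
  have cnu x2 : {for x2, continuous nu}.
    by apply: smooth_vector_map_continuous; case: gnu.
  (* The sign is -1 at [x'], continuous, and always 1 or -1, so it stays -1 nearby. *)
  have nT : \forall z \near x', nu z = - act r (nu (T z)).
    have c3 : {for x', continuous (fun z => dotv (nu z) (act r (nu (T z))))}.
      apply: dotv_continuous; first exact: cnu.
      have c4 : {for x', continuous (nu \o T)}.
        by apply: continuous_comp => //; exact: cnu.
      exact: (continuous_comp c4 (@act_continuous _ r _)).
    have neg : nbhs (dotv (nu x') (act r (nu (T x')))) [set t : R | t < 0].
      apply: open_nbhs_nbhs; split; first exact: open_lt.
      by rewrite /= Tx' nux' dotvNl act_isometry // nn oppr_lt0.
    apply: filterS2 pT (c3 _ neg) => x2 pz /= zneg.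
    have [E k2] := normal_translate imF cp gnu so rr pz; rewrite E.
    by rewrite (neg_sqr_eq1 zneg k2) scaleN1r.
  have psiT x2 : p x2 = tau (p (T x2)) -> nu x2 = - act r (nu (T x2)) ->
      psit x2 = - wedge (act r (F (p (T x2)))) (act r (nu (T x2))).
    by move=> pz nz; rewrite /psit /bipolar pz nz wedgeNr /F lawson_map_translate.
  have psiT0 := psiT _ (nbhs_singleton pT) (nbhs_singleton nT).
  have omr u v : dotv (wedge b (act r a) + l *: wedge c' (- act r (nu x)))
      (wedge (act r u) (act r v)) =
      dotv (wedge b a + l *: wedge c' (nu x)) (wedge u v).
    rewrite !dotvDl !dotvZl -(wedge_isometry b a u v so) rb.
    by rewrite -(wedge_isometry c' (nu x) u v so) rc' wedgeNl wedgeNr.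
  apply: (conormal_pullback (F := psit) (G := psit) (h := T) (a := wedge b a + l *: wedge c' (nu x))) => //.
    by rewrite Tx'.
  apply: filterS2 pT nT => x2 pz nz; rewrite (psiT x2 pz nz) psiT0.
  rewrite !(dotvBl, dotvBr, dotvNl, dotvNr) !omr !wedge_isometry //.
  by split; ring.
have y0 : y != 0 by [].
have z0 : z != 0.
  by apply/eqP => z0; move: ad1; rewrite -/y -yz z0 expr0n addr0 eqxx.
by move/eqP: s0; rewrite /s !mulf_eq0 (negPf y0) (negPf z0) pnatr_eq0.
Qed.

End Corner.

(** * The polygons *)

Section Reflections.
Context {R : realType}.

(** [is_reflection] only characterizes a matrix; here it is diag(1, 1, -1, -1) conjugated by the
    frame, whose two minus signs give determinant 1. *)
Lemma reflection_exists (b d w1 w2 : 'rV[R]_4) : orthonormal4 b d w1 w2 ->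
  exists r : 'M[R]_4, [/\ special_orthogonal r, act r b = b, act r d = d &
    forall w, dotv w b = 0 -> dotv w d = 0 -> act r w = - w].
Proof.
move=> frame; have MM := frame_mx_orthogonal frame; have MM' := mulmx1C MM.
set M := frame_mx b d w1 w2 in MM MM'.
pose s : 'rV[R]_4 := \row_i nth 0 [:: 1; 1; -1; -1] i.
pose D := diag_mx s.
have DD : D *m D = 1%:M.
  apply/matrixP => i j; rewrite mul_diag_mx !mxE.
  case: (i == j); last by rewrite mulr0n mulr0.
  by case: i => [[|[|[|[|i]]]] Hi] //=; rewrite ?mulrNN mulr1.
pose r := M^T *m D *m M.
have rT : r^T = r by rewrite /r !trmx_mul trmxK tr_diag_mx mulmxA.
have actr w : act r w = w *m M^T *m D *m M by rewrite /act rT /r !mulmxA.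
have wM w i : (w *m M^T) 0 i = dotv (nth 0 [:: b; d; w1; w2] i) w.
  by rewrite mxE dotvC; apply: eq_bigr => j _; rewrite !mxE.
have fixed w : dotv w w1 = 0 -> dotv w w2 = 0 -> act r w = w.
  move=> ww1 ww2; rewrite actr (_ : w *m M^T *m D = w *m M^T).
    by rewrite -mulmxA MM' mulmx1.
  apply/rowP => i; rewrite mul_mx_diag [LHS]mxE wM [s 0 i]mxE.
  by case: i => [[|[|[|[|i]]]] Hi] //=; rewrite ?mulr1 // dotvC ?ww1 ?ww2 mul0r.
have [_ [bd bw1 bw2 [dw1 dw2 _]]] := frame.
exists r; split.
- split.
    rewrite rT /r !mulmxA -(mulmxA _ M) MM mulmx1 -(mulmxA M^T D D) DD mulmx1.
    exact: MM'.
  rewrite /r !det_mulmx mulrAC -det_mulmx MM' det1 mul1r det_diag.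
  by rewrite !big_ord_recl big_ord0 !mxE /= !mul1r mulr1 mulrNN mulr1.
- exact: fixed.
- exact: fixed.
move=> w wb wd; rewrite actr (_ : w *m M^T *m D = - (w *m M^T)).
  by rewrite mulNmx -mulmxA MM' mulmx1.
apply/rowP => i; rewrite mul_mx_diag [LHS]mxE [RHS]mxE wM [s 0 i]mxE.
by case: i => [[|[|[|[|i]]]] Hi] //=;
  rewrite ?mulrN ?mulr1 // dotvC ?wb ?wd oppr0.
Qed.

Lemma dotv_vec4 (x y z w x' y' z' w' : R) :
  dotv (vec4 x y z w) (vec4 x' y' z' w') = x * x' + y * y' + z * z' + w * w'.
Proof. by rewrite /dotv !big_ord_recl big_ord0 !mxE /= addr0 !addrA. Qed.

End Reflections.

Section Polygons.
Context {R : realType}.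
Variables (m k : nat).
Hypotheses (hm : (2 <= m)%N) (hk : (2 <= k)%N).

Lemma vP0 : vP k 0 = vec4 1 0 0 0 :> 'rV[R]_4.
Proof. by rewrite /vP !mul0r cos0 sin0. Qed.

Lemma vP1 : vP k 1 = vec4 (cos (pi / k%:R)) (sin (pi / k%:R)) 0 0 :> 'rV[R]_4.
Proof. by rewrite /vP mul1r. Qed.

Lemma vQ0 : vQ m 0 = vec4 0 0 1 0 :> 'rV[R]_4.
Proof. by rewrite /vQ !mul0r cos0 sin0. Qed.

Lemma vQ1 : vQ m 1 = vec4 0 0 (cos (pi / m%:R)) (sin (pi / m%:R)) :> 'rV[R]_4.
Proof. by rewrite /vQ mul1r. Qed.

Lemma cos_pi_div_sqr (n : nat) : (2 <= n)%N -> cos (pi / n%:R) ^+ 2 != 1 :> R.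
Proof.
move=> n2; have n0 : 0 < n%:R :> R by rewrite ltr0n (leq_trans _ n2).
have s0 : 0 < sin (pi / n%:R) :> R.
  apply: sin_gt0_pi; rewrite divr_gt0 ?pi_gt0 //=.
  by rewrite ltr_pdivrMr // ltr_pMr ?pi_gt0 // ltr1n.
have s2 : 0 < sin (pi / n%:R) ^+ 2 :> R by rewrite exprn_gt0.
by rewrite cos2sin2 lt_eqF //; lra.
Qed.

(** The bound is strict because at n = 2 the vectors [a] and [d] would be orthogonal and the frame
    would turn by pi, whose sine is zero. *)
Lemma cos_pi_div_neq0 (n : nat) : (2 < n)%N -> cos (pi / n%:R) != 0 :> R.
Proof.
move=> n2; have n0 : 0 < n%:R :> R by rewrite ltr0n (leq_trans _ n2).
rewrite gt_eqF // cos_gt0_pihalf //; apply/andP; split.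
  apply: (@lt_trans _ _ 0); last by rewrite divr_gt0 ?pi_gt0.
  by rewrite oppr_lt0 divr_gt0 ?pi_gt0.
by rewrite ltr_pM2l ?pi_gt0 // ltf_pV2 ?posrE // ltr_nat.
Qed.

Lemma shortest_arc_unit (u v : 'rV[R]_4) (s t : R) : dotv u u = 1 ->
  dotv v v = 1 -> dotv u v = 0 -> 0 <= s -> 0 <= t -> s ^+ 2 + t ^+ 2 = 1 ->
  shortest_arc u v (s *: u + t *: v).
Proof.
move=> uu vv uv s0 t0 st; split; last by exists s, t.
rewrite /sphere /= !(dotvDl, dotvDr, dotvZl, dotvZr) uu vv uv (dotvC v) uv.
by rewrite -[RHS]st; ring.
Qed.

End Polygons.

(** In the eta polygon the arc from Q_1 to P_0 is only part of an edge, the half circle from Q_1 to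
    its antipode. It spans the same great circle, so the third edge is described by its plane and an
    inclusion. *)
Lemma polygon_edges (R : realType) (m k : nat) (Gamma : polygon R) :
  Gamma = xi_polygon R m k \/ Gamma = eta_polygon R m k ->
  [/\ Gamma (shortest_edge (vP k 1) (vQ m 1)),
      Gamma (shortest_edge (vQ m 0) (vP k 1)) &
      exists2 e, Gamma e & [/\ edge_u e = vQ m 1, edge_v e = vP k 0 &
        forall x, shortest_arc (vQ m 1) (vP k 0) x -> edge_arc e x]].
Proof.
move=> [] ->.
  split.
  - by left; right.
  - by left; left; right.
  - by exists (shortest_edge (vQ m 1) (vP k 0)); [right|split].
split.
- by left; left; right.
- by left; left; left.
- exists (half_circle_edge (vQ m 1) (vP k 0)); first by left; right.
  split=> // x [xs [s [t [_ t0 xE]]]].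
  exact: (conj xs (ex_intro _ s (ex_intro _ t (conj t0 xE)))).
Qed.

Theorem corollary4p3 (R : realType) (m k : nat)
  (hm : (2 <= m)%N) (hk : (2 <= k)%N) (hmk : (2 < m)%N \/ (2 < k)%N)
  (Gamma : polygon R)
  (hGamma : Gamma = xi_polygon R m k \/ Gamma = eta_polygon R m k)
  (f : 'rV[R]_2 -> 'rV[R]_4) (hf : plateau_solution Gamma f)
  (A : smooth_structure R (lawson_space Gamma f))
  (hclosed : closed_surface (Surface A))
  (hpsi : minimal_immersion (M := Surface A) (lawson_map (Gamma := Gamma) (f := f)))
  (Sbar : surface R) (p : Sbar -> Surface A) (hp : orientation_cover p)
  (nubar : Sbar -> 'rV[R]_4)
  (hnubar : gauss_map (fun x => lawson_map (p x)) nubar) :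
  ~ embedded_surface (bipolar (fun x => lawson_map (p x)) nubar).
Proof.
have span : disk_spanning Gamma f by case: hf => -[+ _] _ _ _ _.
have [PQ QP [e Ge [eu ev earc]]] := polygon_edges hGamma.
have PP (i j : nat) : dotv (vP k i) (vQ m j) = 0 :> R.
  by rewrite dotv_vec4 !mulr0 !mul0r !addr0.
have QQ (i j : nat) : dotv (vQ m j) (vP k i) = 0 :> R by rewrite dotvC PP.
have cs (t : R) : cos t * cos t + sin t * sin t = 1.
  by rewrite -!expr2 cos2Dsin2.
have P11 i : dotv (vP k i) (vP k i) = 1 :> R.
  by rewrite dotv_vec4 !mulr0 !addr0.
have Q11 i : dotv (vQ m i) (vQ m i) = 1 :> R.
  by rewrite dotv_vec4 !mulr0 !add0r.
have P10 : dotv (vP k 1) (vP k 0) = cos (pi / k%:R) :> R.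
  by rewrite vP0 vP1 dotv_vec4 !mulr0 !addr0 mulr1.
have Q10 : dotv (vQ m 1) (vQ m 0) = cos (pi / m%:R) :> R.
  by rewrite vQ0 vQ1 dotv_vec4 !mulr0 !add0r addr0 mulr1.
have arc s t u v : dotv u u = 1 -> dotv v v = 1 -> dotv u v = 0 ->
    Gamma (shortest_edge u v) -> 0 <= s -> 0 <= t -> s ^+ 2 + t ^+ 2 = 1 ->
    trace Gamma (s *: u + t *: v).
  move=> uu vv uv Guv s0 t0 st; exists (shortest_edge u v) => //.
  exact: shortest_arc_unit.
have arcC s t u v : dotv u u = 1 -> dotv v v = 1 -> dotv u v = 0 ->
    Gamma (shortest_edge u v) -> 0 <= s -> 0 <= t -> s ^+ 2 + t ^+ 2 = 1 ->
    trace Gamma (s *: v + t *: u).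
  by move=> *; rewrite addrC; apply: arc => //; rewrite addrC.
pose w1 : 'rV[R]_4 := vec4 0 0 (- sin (pi / m%:R)) (cos (pi / m%:R)).
pose w2 : 'rV[R]_4 := vec4 0 1 0 0.
pose z1 : 'rV[R]_4 := vec4 (- sin (pi / k%:R)) (cos (pi / k%:R)) 0 0.
pose z2 : 'rV[R]_4 := vec4 0 0 0 1.
(* The product a . d is the cosine that must be nonzero, while b . c has only to differ from 1 and
   -1; so each case needs just one of the two numbers above 2. *)
have [k3|m3] : (2 < k)%N \/ (2 < m)%N by case: hmk; [right|left].
  have frame : orthonormal4 (vQ m 1) (vP k 0) w1 w2.
    rewrite vP0 vQ1 /w1 /w2; do !split; rewrite dotv_vec4;
      have := cs (pi / m%:R); lra.
  have [r [so rb rd rw]] := reflection_exists frame.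
  have er : is_reflection e r.
    split=> // [s t|w]; rewrite eu ev; last exact: rw.
    by rewrite act_add !act_scale rb rd.
  refine (corner_not_embedded span hpsi hp hnubar (P11 1) (Q11 1) (Q11 0)
    (P11 0) (PP _ _) (PP _ _) (PP _ _) (PP _ _) _ _ _ _ _ Ge _ er rb rd rw).
  - by rewrite Q10; exact: cos_pi_div_sqr.
  - by rewrite P10; exact: cos_pi_div_neq0.
  - by rewrite P10; exact: cos_pi_div_sqr.
  - by move=> s t; exact: arc.
  - by move=> s t; exact: arcC.
  - by move=> s t s0 t0 st; apply: earc; exact: shortest_arc_unit.
have frame : orthonormal4 (vP k 1) (vQ m 0) z1 z2.
  rewrite vQ0 vP1 /z1 /z2; do !split; rewrite dotv_vec4;
    have := cs (pi / k%:R); lra.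
have [r [so rb rd rw]] := reflection_exists frame.
have er : is_reflection (shortest_edge (vQ m 0) (vP k 1)) r.
  split=> // [s t|w wd wb]; last exact: rw.
  by rewrite /= act_add !act_scale rb rd.
(* This edge lists its endpoints in the order [d], [b]. *)
have rw' w : dotv w (vP k 1) = 0 -> dotv w (vQ m 0) = 0 -> act r w = - w.
  by move=> wb wd; apply: rw.
refine (corner_not_embedded span hpsi hp hnubar (Q11 1) (P11 1) (P11 0)
  (Q11 0) (QQ _ _) (QQ _ _) (QQ _ _) (QQ _ _) _ _ _ _ _ QP _ er rb rd rw').
- by rewrite P10; exact: cos_pi_div_sqr.
- by rewrite Q10; exact: cos_pi_div_neq0.
- by rewrite Q10; exact: cos_pi_div_sqr.
- by move=> s t; exact: arcC.
- move=> s t s0 t0 st; exists e => //; apply: earc; exact: shortest_arc_unit.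
- by move=> s t s0 t0 st; rewrite addrC; apply: shortest_arc_unit; rewrite // addrC.
Qed.
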